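(* Let $G$ be a (locally finite) Cayley graph or Cayley diagram, and let $\omega$ be an $\mathrm{Aut}(G)$-invariant percolation on $G$. Let $\delta$ be a factor of iid decoration on $(G,\omega)$, where the iid labels $\lambda:V(G)\to[0,1]$ used for the factor are independent from the percolation $\omega$. Suppose that all the components of $\omega$ are infinite and indistinguishable with scenery. Then they are also indistinguishable with scenery in the full decoration of $\omega$ with the fiid; that is, the decorated rooted graph $(\omega_o,o;G,\omega,(\delta(\lambda,v))_{v\in V(G)})$ is ergodic.
   Context: A Cayley diagram of a group with finite generating set $S$ is the graph on the group with an oriented edge from $x$ to $xg$ colored by $g$, for each $x$ and each $g\in S$; the Cayley graph is obtained by forgetting orientations and colors. $\mathrm{Aut}(G)$ is the automorphism group of $G$ (preserving orientations and colors for a diagram). A percolation on $G$ is a random subgraph of $G$; it is $\mathrm{Aut}(G)$-invariant if its distribution is. $\omega_o$ is the connected component in $\omega$ of a fixed vertex $o$ of $G$. Decorated rooted graphs. A decorated rooted graph $(H,o;\ldots)$ is a connected locally finite graph $H$ with root $o\in V(H)$ together with a decoration: a set $V'$ of extra vertices, a set $E'$ of extra (possibly oriented) edges on $V(H)\cup V'$ such that $(V(H)\cup V',E(H)\cup E')$ is connected, and a partial coloring of $V(H)\cup V'\cup E(H)\cup E'$ by elements of a complete separable metric space. These are considered up to rooted isomorphism preserving all structure (which structure belongs to $H$ and which to the decoration, and the colors); the resulting space $\mathcal{G}_*$ carries the local metric in which two decorated rooted graphs are at distance at most $1/r$ if there is a rooted isomorphism of the $r$-balls around the roots in $(V(H)\cup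 V',E(H)\cup E')$, which also maps the $r$-ball in $H$ isometrically to that in the other graph, and matches colors up to $1/r$. A unimodular random decorated graph $(H,o;\ldots)$ is ergodic if every invariant property, i.e. every Borel $\mathcal{A}\subset\mathcal{G}_*$ closed under moving the root to any other vertex of $H$, has probability 0 or 1. $(\omega_o,o;G,\omega)$ denotes the random rooted graph $(\omega_o,o)$ decorated by its scenery, i.e. by $G$ and $\omega$; it is unimodular. The components of $\omega$ are indistinguishable with scenery if $(\omega_o,o;G,\omega)$ is ergodic. With an additional decoration $\delta$ of $V(G)$, indistinguishability with scenery means ergodicity of $(\omega_o,o;G,\omega,(\delta(\lambda,v))_{v\in V(G)})$. Factor of iid (fiid) decoration: $\lambda$ consists of iid uniform $[0,1]$ labels on $V(G)$, and $\delta(\lambda,v)=f$ applied to $(G,\omega,\lambda)$ rooted at $v$, where $f$ is a fixed Borel function on rooted decorated graphs with values in a separable metric space. *)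

(* Defs.v *)
From HB Require Import structures.
From mathcomp Require Import all_boot all_order all_algebra.
From mathcomp Require Import all_classical all_reals all_analysis.

Set Implicit Arguments.
Unset Strict Implicit.
Unset Printing Implicit Defensive.

Import Order.TTheory GRing.Theory Num.Theory.
Import numFieldNormedType.Exports.

Local Open Scope classical_set_scope.
Local Open Scope ring_scope.

Fixpoint walk (V : Type) (adj : V -> V -> Prop) (n : nat) (x y : V) : Prop :=
  if n is m.+1 then exists2 z, adj x z & walk adj m z y else x = y.

Definition dist_le (V : Type) (adj : V -> V -> Prop) (n : nat) (x y : V) : Prop :=
  exists2 m, (m <= n)%N & walk adj m x y.

Definition connected_by (V : Type) (adj : V -> V -> Prop) (x y : V) : Prop :=
  exists n, walk adj n x y.

Definition adj_by (V E : Type) (joins : E -> V -> V -> Prop) (F : set E)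
    (x y : V) : Prop :=
  exists2 e, F e & joins e x y \/ joins e y x.

(* Connected locally finite graphs whose edges may be oriented and partially
   coloured by C.  An edge from x to y satisfies [joins e x y], and nothing
   else if it is oriented; an unoriented edge satisfies both [joins e x y] and
   [joins e y x].  Loops and parallel edges are allowed. *)
Record graph (C : Type) := Graph {
  vertex : Type;
  edge : Type;
  joins : edge -> vertex -> vertex -> Prop;
  ecol : edge -> option C;
  joinsP : forall e, exists x y, joins e x y /\
    forall u v, joins e u v -> (u = x /\ v = y) \/ (u = y /\ v = x);
  graph_connected : forall x y, connected_by (adj_by joins setT) x y;
  graph_locally_finite : forall x,
    finite_set [set e | exists y, joins e x y \/ joins e y x]
}.
Arguments joins {C g}.
Arguments ecol {C g}.
Arguments Graph {C vertex edge joins} ecol joinsP.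

Definition adj (C : Type) (G : graph C) (F : set (edge G)) :=
  adj_by (@joins C G) F.

Definition recolor (C D : Type) (G : graph C) (c : edge G -> option D) : graph D :=
  Graph c (@joinsP C G) (@graph_connected C G) (@graph_locally_finite C G).

Record automorphism (C : Type) (G : graph C) := Automorphism {
  autv : vertex G -> vertex G;
  aute : edge G -> edge G;
  autv_bij : bijective autv;
  aute_bij : bijective aute;
  aut_joins : forall e x y, joins e x y <-> joins (aute e) (autv x) (autv y);
  aut_ecol : forall e, ecol (aute e) = ecol e
}.

Record subgraph (C : Type) (G : graph C) := Subgraph {
  sub_v : set (vertex G);
  sub_e : set (edge G);
  sub_ends : forall e x y, sub_e e -> joins e x y -> sub_v x /\ sub_v y
}.

Lemma aut_image_ends (C : Type) (G : graph C) (a : automorphism G)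
    (w : subgraph G) e x y :
  (aute a @` sub_e w) e -> joins e x y ->
  (autv a @` sub_v w) x /\ (autv a @` sub_v w) y.
Proof.
case=> e' we' <-; have [b ab ba] := autv_bij a.
rewrite -[x]ba -[y]ba => H; have [bx bw] := sub_ends we' ((aut_joins a _ _ _).2 H).
by split; [exists (b x)|exists (b y)].
Qed.

Definition aut_image (C : Type) (G : graph C) (a : automorphism G)
    (w : subgraph G) : subgraph G :=
  Subgraph (@aut_image_ends C G a w).

(* The product sigma-algebra on subgraphs, regarded as elements of
   {0,1}^V(G) x {0,1}^E(G). *)
Definition subgraph_measurable (C : Type) (G : graph C) : set (set (subgraph G)) :=
  <<s [set A | (exists v, A = [set w | sub_v w v]) \/
               (exists e, A = [set w | sub_e w e])] >>.

(* The vertex set of the component of o in w; it is {o} if o is not in w. *)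
Definition component (C : Type) (G : graph C) (w : subgraph G) (o : vertex G) :
    set (vertex G) :=
  [set v | connected_by (adj (sub_e w)) o v].

Definition component_edges (C : Type) (G : graph C) (w : subgraph G)
    (o : vertex G) : set (edge G) :=
  [set e | sub_e w e /\
    forall x y, joins e x y -> component w o x /\ component w o y].

Section walks.
Variables (V : Type) (r : V -> V -> Prop).

Lemma connected_refl x : connected_by r x x.
Proof. by exists 0%N. Qed.

Lemma connected_trans y x z :
  connected_by r x y -> connected_by r y z -> connected_by r x z.
Proof.
case=> n; elim: n x => [x /= -> //|n IH x /= [t xt ty] yz].
by have [m tz] := IH _ ty yz; exists m.+1, t.
Qed.

Lemma connected1 x y : r x y -> connected_by r x y.
Proof. by move=> xy; exists 1%N, y. Qed.

Lemma connected_sym x y : (forall u v, r u v -> r v u) ->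
  connected_by r x y -> connected_by r y x.
Proof.
move=> rC [n]; elim: n x => [x /= ->|n IH x /= [t xt /IH ty]].
  exact: connected_refl.
by apply: connected_trans ty _; apply: connected1; exact: rC.
Qed.

End walks.

Lemma adj_by_sym (V E : Type) (j : E -> V -> V -> Prop) F x y :
  adj_by j F x y -> adj_by j F y x.
Proof. by case=> e Fe exy; exists e => //; tauto. Qed.

(* Gam is a Type with a group structure, and not a groupType, because the sets
   of graphs below require the vertices to be in a universe smaller than that
   of the carriers of groupType. *)
Section cayley.
Variables (Gam : Type) (grp : Group.axioms_ Gam).
HB.instance Definition _ := grp.
Variable S : set Gam.

Definition generates : Prop :=
  forall H : set Gam, S `<=` H -> H 1%g ->
    (forall x y, H x -> H y -> H (x * y)%g) -> (forall x, H x -> H x^-1%g) ->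
    H = setT.

Hypotheses (finS : finite_set S) (genS : generates).

Lemma cayley_connected (r : Gam -> Gam -> Prop) :
  (forall x y, r x y -> r y x) ->
  (forall x g, S g -> r x (x * g)%g) -> forall x y, connected_by r x y.
Proof.
move=> rC rS x y.
have HT : [set g | forall x, connected_by r x (x * g)%g] = setT.
  apply: genS => [g Sg z|z|g h /= Hg Hh z|g /= Hg z].
  - exact/connected1/rS.
  - by rewrite mulg1; exact: connected_refl.
  - by rewrite mulgA; exact: connected_trans (Hg z) (Hh _).
  - by apply: connected_sym => //; have := Hg (z * g^-1)%g; rewrite mulgVK.
have : [set g | forall x, connected_by r x (x * g)%g] (x^-1 * y)%g by rewrite HT.
by move/(_ x); rewrite mulVKg.
Qed.

Definition diagram_joins (e : Gam * {g | S g}) (u v : Gam) : Prop :=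
  u = e.1 /\ v = (e.1 * sval e.2)%g.

Lemma diagram_joinsP e : exists x y, diagram_joins e x y /\
  forall u v, diagram_joins e u v -> (u = x /\ v = y) \/ (u = y /\ v = x).
Proof. by exists e.1, (e.1 * sval e.2)%g; split=> // u v []; left. Qed.

Lemma diagram_connected x y : connected_by (adj_by diagram_joins setT) x y.
Proof.
apply: cayley_connected => {x y} [x y|x g Sg]; first exact: adj_by_sym.
by exists (x, exist _ g Sg) => //; left.
Qed.

Lemma diagram_locally_finite x :
  finite_set [set e | exists y, diagram_joins e x y \/ diagram_joins e y x].
Proof.
pose F := [set (x, g) | g in S] `|` [set ((x * g^-1)%g, g) | g in S].
have finF : finite_set F by rewrite finite_setU; split; exact: finite_image.
apply: (@sub_finite_set _ _
  ((fun e : Gam * {g | S g} => (e.1, sval e.2)) @^-1` F)).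
  move=> [z [g Sg]] [y] [] [/= yz xz]; [left|right]; exists g; rewrite // ?yz //.
  by rewrite xz mulgK.
apply: finite_preimage finF => -[a [g Sg]] [b [h Sh]] _ _ /= [-> gh].
by congr pair; exact: eq_exist.
Qed.

Definition cayley_diagram : graph Gam :=
  Graph (fun e : Gam * {g | S g} => Some (sval e.2))
    diagram_joinsP diagram_connected diagram_locally_finite.

(* Forgetting orientations and colours leaves the edges {x, xg}, so that the
   two edges given by g and g^-1, if both are in S, become the same edge. *)
Definition cayley_edge : Type :=
  {e : Gam -> Prop | exists x g, S g /\ e = [set x; (x * g)%g]}.

Definition cayley_joins (e : cayley_edge) (u v : Gam) : Prop :=
  sval e = [set u; v].

Lemma pair_setP (T : Type) (u v x y : T) : [set u; v] = [set x; y] ->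
  (u = x /\ v = y) \/ (u = y /\ v = x).
Proof.
move=> E.
have [] : [set x; y] u by rewrite -E; left.
all: have [] : [set x; y] v by rewrite -E; right.
all: have [] : [set u; v] x by rewrite E; left.
all: have [] : [set u; v] y by rewrite E; right.
all: by move=> /= -> -> *; subst; auto.
Qed.

Lemma cayley_joinsP e : exists x y, cayley_joins e x y /\
  forall u v, cayley_joins e u v -> (u = x /\ v = y) \/ (u = y /\ v = x).
Proof.
case: e => e [x [g [Sg E]]].
exists x, (x * g)%g; split=> // u v.
by rewrite /cayley_joins/= E => H; apply: pair_setP; rewrite H.
Qed.

Lemma cayley_graph_connected x y : connected_by (adj_by cayley_joins setT) x y.
Proof.
apply: cayley_connected => {x y} [x y|x g Sg]; first exact: adj_by_sym.
have He : exists (y : Gam) h, S h /\ [set x; (x * g)%g] = [set y; (y * h)%g].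
  by exists x, g.
by exists (exist _ [set x; (x * g)%g] He : cayley_edge) => //; left.
Qed.

Lemma cayley_graph_locally_finite x :
  finite_set [set e | exists y, cayley_joins e x y \/ cayley_joins e y x].
Proof.
pose F : set (set Gam) := [set [set x; (x * g)%g] | g in S] `|`
                          [set [set (x * g^-1)%g; x] | g in S].
have finF : finite_set F by rewrite finite_setU; split; exact: finite_image.
apply: (@sub_finite_set _ _ ((fun e : cayley_edge => sval e) @^-1` F)).
  move=> [e [z [g [Sg E]]]] [y H]; rewrite /F /=.
  have : [set x; y] = [set z; (z * g)%g].
    by case: H; rewrite /cayley_joins/= E => ->; rewrite // setUC.
  move=> H'; case: (pair_setP H') => [][-> _]; [left|right]; exists g => //.
  by rewrite mulgK E.
by apply: finite_preimage finF => -[a Ha] [b Hb] _ _ /= ab; exact: eq_exist.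
Qed.

Definition cayley_graph : graph Gam :=
  Graph (fun=> None) cayley_joinsP cayley_graph_connected
    cayley_graph_locally_finite.

End cayley.

(* [under] is the graph (V(H) u V', E(H) u E') with the edge colouring; H has
   vertex set [hv] and edge set [he].  The colours of vertices and of edges are
   taken in two spaces, that is, in their disjoint union. *)
Record dgraph (CV CE : Type) := DGraph {
  under :> graph CE;
  vcol : vertex under -> option CV;
  hv : set (vertex under);
  he : set (edge under);
  root : vertex under;
  root_hv : hv root;
  he_ends : forall e x y, he e -> joins e x y -> hv x /\ hv y;
  h_connected : forall x y, hv x -> hv y -> connected_by (adj he) x y
}.
Arguments root {CV CE}.
Arguments hv {CV CE}.
Arguments he {CV CE}.
Arguments vcol {CV CE}.

Definition reroot (CV CE : Type) (X : dgraph CV CE) (v : vertex X) (Hv : hv X v) :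
    dgraph CV CE :=
  DGraph (vcol X) Hv (@he_ends _ _ X) (@h_connected _ _ X).

Section local_topology.
Variables (R : realType) (CV CE : pseudoMetricType R).
Implicit Types X Y : dgraph CV CE.

Definition ballv (r : nat) X : set (vertex X) :=
  [set v | dist_le (adj setT) r (root X) v].

Definition balle (r : nat) X : set (edge X) :=
  [set e | forall x y, joins e x y -> ballv r x /\ ballv r y].

Definition hballv (r : nat) X : set (vertex X) :=
  [set v | dist_le (adj (he X)) r (root X) v].

Definition hballe (r : nat) X : set (edge X) :=
  [set e | he X e /\ forall x y, joins e x y -> hballv r x /\ hballv r y].

Definition col_close (C : pseudoMetricType R) (r : nat) (a b : option C) : Prop :=
  match a, b with
  | Some c, Some c' => ball c r%:R^-1 c'
  | None, None => True
  | _, _ => False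
  end.

(* X and Y are at distance at most 1/r in the local metric. *)
Definition local_close (r : nat) X Y : Prop :=
  exists (p : vertex X -> vertex Y) (q : edge X -> edge Y),
    [/\ p (root X) = root Y,
        set_bij (@ballv r X) (@ballv r Y) p,
        set_bij (@balle r X) (@balle r Y) q &
        forall e x y, balle r e -> ballv r x -> ballv r y ->
          joins e x y <-> joins (q e) (p x) (p y)] /\
    [/\ p @` (@hballv r X) = @hballv r Y,
        q @` (@hballe r X) = @hballe r Y &
        forall x y n, hballv r x -> hballv r y ->
          dist_le (adj (he X)) n x y <-> dist_le (adj (he Y)) n (p x) (p y)] /\
    (forall x, ballv r x -> col_close r (vcol X x) (vcol Y (p x))) /\
    (forall e, balle r e -> col_close r (ecol e) (ecol (q e))).

Definition local_open (U : set (dgraph CV CE)) : Prop :=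
  forall X, U X -> exists2 r, (0 < r)%N & forall Y, local_close r X Y -> U Y.

(* The graphs are not quotiented by isomorphism: isomorphic decorated rooted
   graphs are at distance 0, so they are in the same open sets, hence in the
   same Borel sets, and these are the Borel sets of the quotient. *)
Definition dgraph_borel : set (set (dgraph CV CE)) := <<s local_open >>.

Definition borel_fun (Xi : topologicalType) (f : dgraph CV CE -> Xi) : Prop :=
  forall U : set Xi, open U -> dgraph_borel (f @^-1` U).

Definition root_invariant (A : set (dgraph CV CE)) : Prop :=
  forall X (v : vertex X) (Hv : hv X v), A X -> A (reroot Hv).

Definition ergodic_given d (T : measurableType d) (P : probability T R)
    (D : set T) (X : T -> dgraph CV CE) : Prop :=
  forall A, dgraph_borel A -> root_invariant A ->
    P (D `&` X @^-1` A) = 0%E \/ P (D `&` X @^-1` A) = P D.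

End local_topology.

(* Whether the edge is in the percolation, and its colour in G, if any. *)
Definition edge_mark (K : Type) : Type :=
  (bool * discrete_topology {classic option K})%type.

Section scenery.
Variables (K : Type) (G : graph K).

Definition mark_edges (w : subgraph G) : graph (edge_mark K) :=
  recolor (fun e => Some (`[< sub_e w e >], ecol e : discrete_topology _)).

Lemma component_conn (w : subgraph G) o x : component w o x ->
  connected_by (adj (component_edges w o)) o x.
Proof.
suff H n y : component w o y -> walk (adj (sub_e w)) n y x ->
    connected_by (adj (component_edges w o)) y x.
  by case=> n; apply: H; exact: connected_refl.
elim: n y => [y _ /= ->|n IH y oy /= [z yz zx]]; first exact: connected_refl.
have oz : component w o z by apply: connected_trans oy _; exact: connected1.
apply: connected_trans (IH _ oz zx); apply: connected1.
case: yz => e we yz; exists e => //; split=> // u v uv.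
have [a [b [_ H]]] := joinsP e.
case: (H _ _ uv) => [][-> ->]; case: yz => /H[][? ?]; subst; by split.
Qed.

Lemma component_connected (w : subgraph G) o x y :
  component w o x -> component w o y ->
  connected_by (adj (component_edges w o)) x y.
Proof.
move=> /component_conn ox /component_conn; apply: connected_trans.
by apply: connected_sym ox => u v; exact: adj_by_sym.
Qed.

(* (w_o, o; G, w), with vertices coloured by c. *)
Definition scenery (CV : Type) (w : subgraph G) (c : vertex G -> CV)
    (o : vertex G) : dgraph CV (edge_mark K) :=
  @DGraph CV (edge_mark K) (mark_edges w) (fun v => Some (c v))
    (component w o) (component_edges w o) o (connected_refl _ o)
    (fun e x y He => He.2 x y) (@component_connected w o).

(* (G, w) rooted at o, with vertices coloured by c. *)
Definition whole (CV : Type) (w : subgraph G) (c : vertex G -> CV)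
    (o : vertex G) : dgraph CV (edge_mark K) :=
  @DGraph CV (edge_mark K) (mark_edges w) (fun v => Some (c v))
    setT setT o I (fun _ _ _ _ _ => conj I I)
    (fun x y _ _ => @graph_connected K G x y).

Definition fiid (L Xi : Type) (f : dgraph (bool * L) (edge_mark K) -> Xi)
    (w : subgraph G) (la : vertex G -> L) (v : vertex G) : Xi :=
  f (whole w (fun x => (`[< sub_v w x >], la x)) v).

End scenery.

Section random.
Variables (R : realType) (d : measure_display) (T : measurableType d).
Variables (P : probability T R) (K : Type) (G : graph K).

Definition percolation (om : T -> subgraph G) : Prop :=
  forall A, subgraph_measurable A -> measurable (om @^-1` A).

Definition aut_invariant (om : T -> subgraph G) : Prop :=
  forall (a : automorphism G) A, subgraph_measurable A ->
    P ((fun t => aut_image a (om t)) @^-1` A) = P (om @^-1` A).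

Definition all_components_infinite (om : T -> subgraph G) : Prop :=
  {ae P, forall t, forall v, sub_v (om t) v -> infinite_set (component (om t) v)}.

(* If om may omit vertices, then (om_o, o; G, om) is conditioned on o being
   a vertex of om. *)
Definition indistinguishable_with_scenery (om : T -> subgraph G)
    (o : vertex G) : Prop :=
  @ergodic_given R bool (edge_mark K) d T P [set t | sub_v (om t) o]
    (fun t => scenery (om t) (fun v => `[< sub_v (om t) v >]) o).

Definition indistinguishable_with_decorated_scenery (Xi : pseudoMetricType R)
    (om : T -> subgraph G) (de : T -> vertex G -> Xi) (o : vertex G) : Prop :=
  @ergodic_given R (bool * Xi)%type (edge_mark K) d T P
    [set t | sub_v (om t) o]
    (fun t => scenery (om t) (fun v => (`[< sub_v (om t) v >], de t v)) o).

Definition iid_uniform01 (I : Type) (la : I -> {RV P >-> R}) : Prop :=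
  (forall i B, measurable B ->
     P (la i @^-1` B) = uniform_prob (@ltr01 R) B) /\
  (forall n (i : 'I_n -> I) (B : 'I_n -> set R),
     injective i -> (forall k, measurable (B k)) ->
     P (\bigcap_(k in [set: 'I_n]) (la (i k) @^-1` B k)) =
     (\prod_(k < n) P (la (i k) @^-1` B k))%E).

Definition labels_sigma (I : Type) (la : I -> {RV P >-> R}) : set (set T) :=
  <<s [set A | exists i B, measurable B /\ A = la i @^-1` B] >>.

Definition independent_of_labels (om : T -> subgraph G)
    (I : Type) (la : I -> {RV P >-> R}) : Prop :=
  forall A B, subgraph_measurable A -> labels_sigma la B ->
    P (om @^-1` A `&` B) = (P (om @^-1` A) * P B)%E.

End random.

(* Main.v *)
(* Condition on the percolation w.  For a root-invariant property A, let E(w, x) be the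
   set of labellings for which the decorated component of x in w has A; it depends only
   on the component of x, and it is measurable in the labels, so that it is within eta
   of some event F_x depending on finitely many labels around x.  There are countably
   many candidates for F, up to translation, and by mass transport, an infinite
   component containing a vertex where a given F is good contains infinitely many of
   them almost surely.  For two such vertices x, y far apart, F_x and F_y are
   independent, and E(w, x) = E(w, y), so the probability p of E(w, x) satisfies
   p (1 - p) <= 4 eta.  Hence p is 0 or 1.

   It remains to see that {p = 1} is, up to a null set, an invariant Borel property of
   the scenery.  It is a countable union of closed sets S of subgraphs up to a null set.
   By compactness, a scenery which is in the local closure of the sceneries in S, from
   any root in the component, is isomorphic to one in S, hence has p = 1. *)
From HB Require Import structures.
Require Import Defs.
From mathcomp Require Import all_boot all_order all_algebra.
From mathcomp Require Import all_classical all_reals all_analysis measurable_realfun.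
From mathcomp Require Import lra.

Set Implicit Arguments.
Unset Strict Implicit.
Unset Printing Implicit Defensive.

Import Order.TTheory GRing.Theory Num.Theory.
Import numFieldNormedType.Exports.
(* Again, since the order library shadows [joins]. *)
Import Defs.

Local Open Scope classical_set_scope.
Local Open Scope ring_scope.

(** * Graphs and isomorphisms *)

(** The event F must come from a countable list fixed in advance because E(w, x) varies with w,
    whereas mass transport handles one equivariant set of vertices at a time; almost surely, all
    formulas and all precisions are then dealt with together.

    The obstacle in the second half is that p is a function of w as a subgraph of G, while
    ergodicity of the scenery speaks of Borel sets of rooted graphs up to isomorphism. Forgetting
    how w sits in G turns a measurable set of subgraphs into a set which is a priori only analytic.
    A closed set of subgraphs behaves better: meeting the local closure of its sceneries from some
    root is a countable union of closed properties, and it adds only subgraphs moved by an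
    automorphism of G or rerooted in the component, since the scenery contains all of G. Neither
    changes p, because the law of the labels is invariant under every permutation of the
    vertices. *)

Section walks.
Variables (V : Type) (r : V -> V -> Prop).

Lemma walk_trans m n x y z : walk r m x y -> walk r n y z -> walk r (m + n)%N x z.
Proof.
elim: m x => [x /= -> //|m IH x /= [t xt ty] yz].
by exists t => //; exact: IH.
Qed.

Lemma walk_sym n x y : (forall u v, r u v -> r v u) ->
  walk r n x y -> walk r n y x.
Proof.
move=> rC; elim: n x => [x /= -> //|n IH x /= [t xt /IH ty]].
have H : walk r 1 t x by exists x => //; exact: rC.
by have := walk_trans ty H; rewrite addn1.
Qed.

Lemma dist_leW m n x y : (m <= n)%N -> dist_le r m x y -> dist_le r n x y.
Proof. by move=> mn [k km w]; exists k => //; exact: leq_trans mn. Qed.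

Lemma dist_le0 n x : dist_le r n x x.
Proof. by exists 0%N. Qed.

Lemma dist_le_sym n x y : (forall u v, r u v -> r v u) ->
  dist_le r n x y -> dist_le r n y x.
Proof. by move=> rC [m mn w]; exists m => //; exact: walk_sym. Qed.

Lemma dist_le_trans m n x y z :
  dist_le r m x y -> dist_le r n y z -> dist_le r (m + n)%N x z.
Proof.
by case=> a am xy [b bn yz]; exists (a + b)%N; [exact: leq_add|exact: walk_trans yz].
Qed.

Lemma dist_leS n x y z : dist_le r n x y -> r y z -> dist_le r n.+1 x z.
Proof.
by move=> xy yz; rewrite -addn1; apply: dist_le_trans xy _; exists 1%N => //; exists z.
Qed.

Lemma dist_leSE n x y : dist_le r n.+1 x y ->
  y = x \/ exists2 z, r x z & dist_le r n z y.
Proof.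
case=> [[|m]] mn /=; first by left.
by case=> z xz zy; right; exists z => //; exists m.
Qed.

End walks.

Lemma walk_map (V V' : Type) (r : V -> V -> Prop) (r' : V' -> V' -> Prop)
    (p : V -> V') n x y :
  (forall u v, r u v -> r' (p u) (p v)) -> walk r n x y -> walk r' n (p x) (p y).
Proof.
move=> H; elim: n x => [x /= -> //|n IH x /= [z xz zy]].
by exists (p z); [exact: H|exact: IH].
Qed.

Lemma dist_le_map (V V' : Type) (r : V -> V -> Prop) (r' : V' -> V' -> Prop)
    (p : V -> V') n x y :
  (forall u v, r u v -> r' (p u) (p v)) ->
  dist_le r n x y -> dist_le r' n (p x) (p y).
Proof. by move=> H [m mn w]; exists m => //; exact: walk_map w. Qed.

Lemma connected_map (V V' : Type) (r : V -> V -> Prop) (r' : V' -> V' -> Prop)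
    (p : V -> V') x y :
  (forall u v, r u v -> r' (p u) (p v)) ->
  connected_by r x y -> connected_by r' (p x) (p y).
Proof. by move=> H [m w]; exists m; exact: walk_map w. Qed.

Section balls.
Variables (C : Type) (G : graph C).
Implicit Types (x y : vertex G) (e : edge G).

Definition incident x : set (edge G) := [set e | exists y, joins e x y \/ joins e y x].

Definition gball n x : set (vertex G) := [set y | dist_le (adj setT) n x y].

Definition gballe n x : set (edge G) :=
  [set e | forall u v, joins e u v -> gball n x u /\ gball n x v].

Lemma joins_ends e x y u v : joins e x y -> joins e u v ->
  (u = x /\ v = y) \/ (u = y /\ v = x).
Proof.
have [a [b [_ H]]] := joinsP e.
by move=> /H [][-> ->] /H; tauto.
Qed.

Lemma finite_neighbours x : finite_set [set y | adj setT x y].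
Proof.
apply: (@sub_finite_set _ _ (\bigcup_(e in incident x)
    [set y | joins e x y \/ joins e y x])).
  by move=> y [e _ exy]; exists e => //; exists y.
apply: bigcup_finite; first exact: graph_locally_finite.
move=> e [y exy].
apply: (@sub_finite_set _ _ ([set y] `|` [set x])); last by rewrite finite_setU; split.
move=> z /= exz; have : z = y \/ z = x; last by [].
by case: exy => exy; case: exz => exz; have [] := joins_ends exy exz => -[? ?];
  subst; auto.
Qed.

Lemma finite_gball n x : finite_set (gball n x).
Proof.
elim: n x => [|n IH] x.
  by apply: sub_finite_set (finite_set1 x) => y [[|//] _ /= ->].
apply: (@sub_finite_set _ _
  ([set x] `|` \bigcup_(z in [set z | adj setT x z]) gball n z)).
  by move=> y Hy; have [->|[z xz zy]] := dist_leSE Hy; [left|right; exists z].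
rewrite finite_setU; split => //.
by apply: bigcup_finite => // ; exact: finite_neighbours.
Qed.

Lemma finite_gballe n x : finite_set (gballe n x).
Proof.
apply: (@sub_finite_set _ _ (\bigcup_(z in gball n x) incident z)).
  move=> e He; have [u [v [uv _]]] := joinsP e.
  by exists u; [have [] := He _ _ uv|exists v; left].
by apply: bigcup_finite => [|z _]; [exact: finite_gball|exact: graph_locally_finite].
Qed.

Lemma gballW m n x : (m <= n)%N -> gball m x `<=` gball n x.
Proof. by move=> mn y; exact: dist_leW. Qed.

Lemma gballeW m n x : (m <= n)%N -> gballe m x `<=` gballe n x.
Proof. by move=> mn e He u v /He [??]; split; exact: gballW mn _ _. Qed.

Lemma bigcup_gball x : \bigcup_n gball n x = setT.
Proof.
rewrite -subTset => y _.
by have [n w] := @graph_connected C G x y; exists n => //; exists n.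
Qed.

Lemma bigcup_gballe x : \bigcup_n gballe n x = setT.
Proof.
rewrite -subTset => e _; have [u [v [uv _]]] := joinsP e.
have : (\bigcup_n gball n x) u by rewrite bigcup_gball.
case=> n _ nu; exists n.+1 => // a b ab.
have nv : gball n.+1 x v by apply: dist_leS nu _; exists e => //; left.
have nu' : gball n.+1 x u by exact: gballW nu.
by case: (joins_ends uv ab) => [][-> ->].
Qed.

Lemma countable_vertex x : countable [set: vertex G].
Proof.
rewrite -(bigcup_gball x); apply: bigcup_countable => // n _.
exact/finite_set_countable/finite_gball.
Qed.

Lemma countable_edge x : countable [set: edge G].
Proof.
rewrite -(bigcup_gballe x); apply: bigcup_countable => // n _.
exact/finite_set_countable/finite_gballe.
Qed.

Lemma adj_sym (F : set (edge G)) x y : adj F x y -> adj F y x.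
Proof. exact: adj_by_sym. Qed.

End balls.

Section components.
Variables (C : Type) (G : graph C).
Implicit Types (w : subgraph G) (x y : vertex G).

Lemma component_refl w x : component w x x.
Proof. exact: connected_refl. Qed.

Lemma component_sym w x y : component w x y -> component w y x.
Proof. by apply: connected_sym => ? ?; exact: adj_sym. Qed.

Lemma component_eq w x y : component w x y -> component w y = component w x.
Proof.
move=> xy; rewrite predeqE => z; split => [|xz]; first exact: connected_trans.
by apply: connected_trans xz; exact: component_sym.
Qed.

Lemma component_edges_eq w x y : component w x y ->
  component_edges w y = component_edges w x.
Proof. by rewrite /component_edges => /component_eq ->. Qed.

End components.

Section isomorphisms.
Variables (CV CE : Type).
Implicit Types X Y : dgraph CV CE.

Record iso (X Y : dgraph CV CE) (p : vertex X -> vertex Y) (q : edge X -> edge Y)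
    : Prop := Iso {
  iso_v : bijective p;
  iso_e : bijective q;
  iso_joins : forall e x y, joins e x y <-> joins (q e) (p x) (p y);
  iso_root : p (root X) = root Y;
  iso_hv : forall x, hv X x <-> hv Y (p x);
  iso_he : forall e, he X e <-> he Y (q e);
  iso_vcol : forall x, vcol Y (p x) = vcol X x;
  iso_ecol : forall e, ecol (q e) = ecol e }.

Lemma iso_sym X Y p q : @iso X Y p q -> exists p' q', @iso Y X p' q'.
Proof.
case=> -[p' pp p'p] [q' qq q'q] J r v e cv ce; exists p', q'; split.
- by exists p.
- by exists q.
- by move=> a x y; rewrite J q'q !p'p.
- by rewrite -r pp.
- by move=> x; rewrite v p'p.
- by move=> x; rewrite e q'q.
- by move=> x; rewrite -cv p'p.
- by move=> x; rewrite -ce q'q.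
Qed.

Lemma iso_adj X Y p q (F : set (edge X)) (F' : set (edge Y)) :
  @iso X Y p q -> (forall e, F e <-> F' (q e)) ->
  forall x y, adj F x y <-> adj F' (p x) (p y).
Proof.
move=> I H x y; split.
  by case=> e /H Fe exy; exists (q e) => //; move: exy; rewrite !(iso_joins I).
case=> e; have [q' qq q'q] := iso_e I.
by rewrite -(q'q e) => /H Fe; rewrite -!(iso_joins I) => exy; exists (q' e).
Qed.

Lemma iso_dist X Y p q (F : set (edge X)) (F' : set (edge Y)) :
  @iso X Y p q -> (forall e, F e <-> F' (q e)) ->
  forall n x y, dist_le (adj F) n x y <-> dist_le (adj F') n (p x) (p y).
Proof.
move=> I H n x y; have A := iso_adj I H; split.
  by apply: dist_le_map => u v; rewrite A.
have [p' pp p'p] := iso_v I.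
rewrite -{2}(pp x) -{2}(pp y); apply: dist_le_map => u v.
by rewrite A !p'p.
Qed.

End isomorphisms.

Section borel_iso.
Variables (R : realType) (CV CE : pseudoMetricType R).
Implicit Types X Y : dgraph CV CE.

Lemma col_close_refl (C : pseudoMetricType R) r (a : option C) :
  (0 < r)%N -> col_close r a a.
Proof. by case: a => //= c r0; apply: ballxx; rewrite invr_gt0 ltr0n. Qed.

Lemma iso_local_close X Y p q r : (0 < r)%N -> @iso _ _ X Y p q ->
  local_close r X Y.
Proof.
move=> r0 I; exists p, q.
have bv x : ballv r x <-> ballv r (p x).
  by rewrite /ballv /= -(iso_root I); apply: iso_dist I _ _ _ _.
have be e : balle r e <-> balle r (q e).
  have [p' pp p'p] := iso_v I.
  split=> H u v.
    rewrite -(p'p u) -(p'p v) -(iso_joins I) => /H.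
    by rewrite !bv.
  by rewrite (iso_joins I) => /H; rewrite !bv.
have hbv x : hballv r x <-> hballv r (p x).
  by rewrite /hballv /= -(iso_root I); apply: (iso_dist I); exact: (iso_he I).
have hbe e : hballe r e <-> hballe r (q e).
  have [p' pp p'p] := iso_v I.
  split=> -[/(iso_he I) he H]; split=> // u v.
    rewrite -(p'p u) -(p'p v) -(iso_joins I) => /H.
    by rewrite !hbv.
  by rewrite (iso_joins I) => /H; rewrite !hbv.
have [p' pp p'p] := iso_v I; have [q' qq q'q] := iso_e I.
split; [split|split; [split|split]].
- exact: iso_root I.
- split=> [x /bv //|x y _ _ /(can_inj pp) //|y]; rewrite -(p'p y) => /bv ?.
  by exists (p' y).
- split=> [x /be //|x y _ _ /(can_inj qq) //|y]; rewrite -(q'q y) => /be ?.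
  by exists (q' y).
- by move=> e x y _ _ _; exact: iso_joins I _ _ _.
- rewrite predeqE => y; split=> [[x /hbv ? <-] //|].
  by rewrite -(p'p y) => /hbv ?; exists (p' y).
- rewrite predeqE => y; split=> [[x /hbe ? <-] //|].
  by rewrite -(q'q y) => /hbe ?; exists (q' y).
- by move=> x y n _ _; apply: (iso_dist I); exact: (iso_he I).
- by move=> x _; rewrite (iso_vcol I); exact: col_close_refl.
- by move=> x _; rewrite (iso_ecol I); exact: col_close_refl.
Qed.

(** Isomorphic graphs are [local_close] at every positive radius, so open sets do not separate them;
    the sets which do not separate them form a sigma-algebra. *)
Lemma borel_iso A X Y p q : dgraph_borel A -> @iso _ _ X Y p q -> A X <-> A Y.
Proof.
move=> bA I.
pose B : set (set (dgraph CV CE)) :=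
  [set A | forall X Y p q, @iso _ _ X Y p q -> A X -> A Y].
pose D : set (set (dgraph CV CE)) :=
  [set A | forall X Y p q, @iso _ _ X Y p q -> A X <-> A Y].
suff : D A by apply; exact: I.
apply: (@smallest_sub _ (sigma_algebra setT) (@local_open R CV CE) D _ _ A bA).
  split.
  - by [].
  - by move=> U DU X1 Y1 p1 q1 I1; rewrite setTD /setC /= (DU _ _ _ _ I1).
  - move=> F DF X1 Y1 p1 q1 I1; split=> -[n _ Fn]; exists n => //.
      exact/(DF n _ _ _ _ I1).
    exact/(DF n _ _ _ _ I1).
move=> U oU.
have H : B U.
  by move=> X1 Y1 p1 q1 I1 /oU [r r0]; apply; exact: iso_local_close I1.
move=> X1 Y1 p1 q1 I1; split; first exact: H I1.
by have [p2 [q2]] := iso_sym I1; exact: H.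
Qed.

End borel_iso.

(** * Measurability *)

Lemma bigcup_countable_measurable d (Y : measurableType d) (U : Type) (D : set U)
    (F : U -> set Y) : countable [set: U] -> (forall i, measurable (F i)) ->
  measurable (\bigcup_(i in D) F i).
Proof.
move=> cU mF; rewrite bigcup_mkcond; apply: countable_bigcupT_measurable => // i.
by case: ifP.
Qed.

Section codes.
Context d (Y : measurableType d).

Definition nat_measurable (k : Y -> nat) := forall n, measurable (k @^-1` [set n]).

(** The set is a union of fibres of the tuple of codes over [J], and such tuples take countably many
    values; this is how it is measurable for an arbitrary [Q]. *)
Lemma measurable_code (I : Type) (h : I -> Y -> nat) (J : set I) (Q : set Y) :
  (forall i, nat_measurable (h i)) -> finite_set J ->
  measurable [set y' | exists2 y, Q y & forall i, J i -> h i y = h i y'].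
Proof.
move=> mh; have -> : finite_set J = @finite_set {classic I} J by [].
case/finite_seqP => s ->.
pose code y := [seq h i y | i <- s].
have mcode c : measurable (code @^-1` [set c]).
  rewrite /code; elim: (s) c => [|i s' IH] [|n c].
  - by rewrite (_ : _ @^-1` _ = setT)//; apply/seteqP; split.
  - by rewrite (_ : _ @^-1` _ = set0)//; apply/seteqP; split.
  - by rewrite (_ : _ @^-1` _ = set0)//; apply/seteqP; split.
  - rewrite (_ : _ @^-1` _ = (h i @^-1` [set n]) `&`
      ((fun y => [seq h i y | i <- s']) @^-1` [set c])).
      by apply: measurableI => //; exact: mh.
    by apply/seteqP; split => [y /= [-> ->] //|y /= [-> ->]].
rewrite (_ : [set _ | _] = \bigcup_(c in code @` Q) (code @^-1` [set c])).
  by apply: bigcup_countable_measurable => //; exact: countableP.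
apply/seteqP; split => [y' [y Qy yy']|y' [_ [y Qy <-]] /= E].
  exists (code y); first by exists y.
  by rewrite /= /code; apply/(@eq_in_map {classic I}) => i si; rewrite (yy' i si).
by exists y => // i si; have /(@eq_in_map {classic I}) H := esym E; exact: H.
Qed.

Variables (R : realType) (CV CE : pseudoMetricType R).

(** An open set is an arbitrary union of balls, so its preimage has to be turned into a countable
    union. Grouping the balls by radius does it: for each [r], the corresponding part of the
    preimage is a union of classes of finitely many codes. *)
Lemma measurable_borel (I : Type) (h : nat -> I -> Y -> nat) (X : Y -> dgraph CV CE)
    (A : set (dgraph CV CE)) :
  (forall r i, nat_measurable (h r i)) ->
  (forall r, (0 < r)%N -> exists2 J, finite_set J & forall y y',
    (forall i, J i -> h r i y = h r i y') -> local_close r (X y) (X y')) ->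
  dgraph_borel A -> measurable (X @^-1` A).
Proof.
move=> mh Hclose bA.
pose D : set (set (dgraph CV CE)) := [set A | measurable (X @^-1` A)].
suff : D A by [].
apply: (@smallest_sub _ (sigma_algebra setT) (@local_open R CV CE) D _ _ A bA).
  split.
  - by rewrite /D /= preimage_set0.
  - by move=> B mB; rewrite /D /= setTD preimage_setC; exact: measurableC.
  - by move=> F mF; rewrite /D /= preimage_bigcup; exact: bigcupT_measurable.
move=> U oU; rewrite /D /=.
have /choice [J HJ] r : exists J, (0 < r)%N -> finite_set J /\ forall y y',
    (forall i, J i -> h r i y = h r i y') -> local_close r (X y) (X y').
  have [r0|] := ltnP 0 r; last by exists set0.
  by have [J ? ?] := Hclose _ r0; exists J.
pose Q r := [set y | forall Z, local_close r (X y) Z -> U Z].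
rewrite (_ : X @^-1` U = \bigcup_(r in [set r | (0 < r)%N])
    [set y' | exists2 y, Q r y & forall i, J r i -> h r i y = h r i y']).
  apply: bigcup_measurable => r r0; apply: measurable_code => //.
  by have [] := HJ _ r0.
apply/seteqP; split => [y /oU [r r0 Hr]|y' [r r0 [y Qy yy']]].
  by exists r => //; exists y.
by apply: Qy; have [_] := HJ _ r0; exact.
Qed.

(** A substitute for measurability with separable range: up to [1/r], the value is determined by a
    measurable integer, as the local metric requires of colours. *)
Definition codable (C : pseudoMetricType R) (c : Y -> C) :=
  forall r, (0 < r)%N -> exists2 k, nat_measurable k &
    forall y y', k y = k y' -> ball (c y) r%:R^-1 (c y').

Lemma codable_bool (b : Y -> bool) : measurable [set y | b y] -> codable b.
Proof.
move=> mb r r0; exists (fun y => nat_of_bool (b y)).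
  move=> [|[|n]].
  - rewrite (_ : _ @^-1` _ = ~` [set y | b y]); first exact: measurableC.
    by apply/seteqP; split => y /=; case: (b y).
  - rewrite (_ : _ @^-1` _ = [set y | b y]) //.
    by apply/seteqP; split => y /=; case: (b y).
  - rewrite (_ : _ @^-1` _ = set0) //.
    by apply/seteqP; split => y /=; case: (b y).
move=> y y' E; have -> : b y = b y' by move: E; case: (b y); case: (b y').
by apply: ballxx; rewrite invr_gt0 ltr0n.
Qed.

Lemma codable_pair (C C' : pseudoMetricType R) (c : Y -> C) (c' : Y -> C') :
  codable c -> codable c' -> codable (fun y => (c y, c' y)).
Proof.
move=> Hc Hc' r r0; have [k mk kc] := Hc r r0; have [k' mk' kc'] := Hc' r r0.
exists (fun y => pickle (k y, k' y)) => [n|y y' /(pcan_inj pickleK) [/kc ? /kc' ?]].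
  rewrite (_ : _ @^-1` _ = \bigcup_(ab in [set ab | pickle ab = n])
      ((k @^-1` [set ab.1]) `&` (k' @^-1` [set ab.2]))).
    apply: bigcup_countable_measurable => [|ab]; first exact: countableP.
    by apply: measurableI.
  apply/seteqP; split => [y /= <-|y [[a b] /= <- [/= -> ->]] //].
  by exists (k y, k' y).
by split.
Qed.

(** The code is the least index of a point of [D] within half of [1/r], so two values with the same
    code are within [1/r] of each other. *)
Lemma codable_dense (M : pseudoMetricType R) (D : set M) (c : Y -> M) :
  countable D -> (forall x e, 0 < e -> exists2 m, D m & ball m e x) ->
  (forall m e, 0 < e -> measurable [set y | ball m e (c y)]) -> codable c.
Proof.
move=> /countable_injP [f finj] dD mc r r0.
pose e : R := r%:R^-1 / 2.
have e0 : 0 < e by rewrite divr_gt0// invr_gt0 ltr0n.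
pose B n := [set y | exists m, [/\ D m, f m = n & ball m e (c y)]].
have mB n : measurable (B n).
  have [[m [Dm fm]]|H] := pselect (exists m, D m /\ f m = n).
    rewrite (_ : B n = [set y | ball m e (c y)]); first exact: mc.
    apply/seteqP; split => [y [m' [Dm' fm' ?]]|y ?]; last by exists m.
    by rewrite (_ : m = m')//; apply: finj; rewrite ?inE// fm.
  rewrite (_ : B n = set0)//; apply/seteqP; split => // y [m [Dm fm _]].
  by apply: H; exists m.
have exB y : exists n, `[< B n y >].
  by have [m Dm b] := dD (c y) _ e0; exists (f m); apply/asboolP; exists m.
exists (fun y => ex_minn (exB y)) => [n|y y'].
  rewrite (_ : _ @^-1` _ = B n `\` \bigcup_(i in `I_n) B i).
    by apply: measurableD => //; exact: bigcup_measurable.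
  apply/seteqP; split => y /=.
    case: ex_minnP => k /asboolP Bk Hk <-; split => // -[i /= ik /asboolP /Hk].
    by rewrite leqNgt ik.
  case=> Bn nB; case: ex_minnP => k /asboolP Bk Hk; apply/eqP.
  rewrite eqn_leq; apply/andP; split; first by apply: Hk; exact/asboolP.
  by rewrite leqNgt; apply/negP => kn; apply: nB; exists k.
case: ex_minnP => n /asboolP [m [Dm <- b]] _.
case: ex_minnP => _ /asboolP [m' [Dm' <- b']] _ /finj E.
have {}E : m = m' by apply: E; rewrite inE.
rewrite -{}E in b'.
by rewrite [_^-1]splitr; apply: ball_triangle b'; exact: ball_sym.
Qed.

End codes.

Section scenery_close.
Variables (R : realType) (K : Type) (G : graph K) (CV : pseudoMetricType R).
Implicit Types (w : subgraph G) (c : vertex G -> CV) (x y z : vertex G).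

Definition agree (N : nat) x w w' :=
  forall e, gballe N x e -> sub_e w e <-> sub_e w' e.

Lemma agree_sym N x w w' : agree N x w w' -> agree N x w' w.
Proof. by move=> H e /H; tauto. Qed.

(** The bound [k] on the distance already covered keeps the rest of the walk inside the ball where
    [w] and [w'] agree. *)
Lemma component_walk N x w w' n k y z : agree N x w w' ->
  gball k x y -> component w' x y -> (k + n <= N)%N ->
  walk (adj (component_edges w x)) n y z -> walk (adj (component_edges w' x)) n y z.
Proof.
move=> ww'; elim: n k y => [//|n IH] k y xy w'y knN /= [t [e [we He] yet] tz].
have xt : gball k.+1 x t by apply: dist_leS xy _; exists e.
have eN : gballe N x e.
  have kN : (k.+1 <= N)%N by apply: leq_trans knN; rewrite addnS ltnS leq_addr.
  move=> u v uv; have Nx := gballW kN xt; have Ny := gballW (ltnW kN) xy.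
  by case: yet => /joins_ends /(_ uv) [][-> ->].
have w'e : sub_e w' e by exact/ww'.
have w't : component w' x t by apply: connected_trans w'y _; apply: connected1; exists e.
exists t; last by apply: IH xt w't _ tz; rewrite addSn -addnS.
exists e => //; split=> // u v uv.
by case: yet => /joins_ends /(_ uv) [][-> ->].
Qed.

(** The origin of [3 * r]: two points within [r] of the root in the component are joined by a path
    of length at most [2 * r], which stays within [3 * r] of the root. *)
Lemma component_dist r x w w' y z n : agree (3 * r) x w w' ->
  dist_le (adj (component_edges w x)) r x y -> dist_le (adj (component_edges w x)) r x z ->
  dist_le (adj (component_edges w x)) n y z -> dist_le (adj (component_edges w' x)) n y z.
Proof.
move=> ww' xy xz yz.
have gb t : dist_le (adj (component_edges w x)) r x t -> gball r x t.
  by apply: (@dist_le_map _ _ _ _ id) => u v [e _ euv]; exists e.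
have xy' : component w' x y.
  case: (xy) => m mr xym; apply: (@connected_map _ _ (adj (component_edges w' x)) _ id).
    by move=> u v [e [we _] euv]; exists e.
  exists m; apply: (component_walk ww' _ _ _ xym (k := 0)) => //.
  - exact: dist_le0.
  - exact: component_refl.
  - by apply: leq_trans mr _; rewrite leq_pmull.
(* If [n] exceeds [2 * r], the walk is replaced by the one through the root. *)
have [m mn yzm] : exists2 m, (m <= minn n (2 * r))%N &
    walk (adj (component_edges w x)) m y z.
  have [n2r|n2r] := leqP n (2 * r)%N; first exact: yz.
  have [//|m mr H] := dist_le_trans (dist_le_sym _ xy) xz; first exact: adj_sym.
  by exists m; rewrite // mul2n -addnn.
exists m; first by apply: leq_trans mn _; rewrite geq_minl.
apply: (component_walk ww' (gb _ xy) xy' _ yzm).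
by rewrite mulSn leq_add2l (leq_trans mn)// geq_minr.
Qed.

Lemma component_ball r x w w' : agree (3 * r) x w w' ->
  dist_le (adj (component_edges w x)) r x `<=`
  dist_le (adj (component_edges w' x)) r x.
Proof.
move=> ww' y xy; apply: component_dist ww' _ _ _ => //; exact: dist_le0.
Qed.

Lemma scenery_close r x w w' c c' : (0 < r)%N -> agree (3 * r) x w w' ->
  (forall v, gball r x v -> ball (c v) r%:R^-1 (c' v)) ->
  @local_close R CV (edge_mark K) r (scenery w c x) (scenery w' c' x).
Proof.
move=> r0 ww' cc'; have w'w := agree_sym ww'.
have hb : dist_le (adj (component_edges w x)) r x =
    dist_le (adj (component_edges w' x)) r x.
  by apply/seteqP; split; exact: component_ball.
have gb t : dist_le (adj (component_edges w x)) r x t -> gball r x t.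
  by apply: (@dist_le_map _ _ _ _ id) => u v [e _ euv]; exists e.
have he e : (forall u v, joins e u v -> dist_le (adj (component_edges w x)) r x u /\
    dist_le (adj (component_edges w x)) r x v) -> gballe (3 * r) x e.
  move=> H u v /H [/gb ? /gb ?].
  by split; apply: (@gballW _ _ r) => //; rewrite leq_pmull.
have sub_comp w1 t : dist_le (adj (component_edges w1 x)) r x t -> component w1 x t.
  case=> m _ mt; apply: (@connected_map _ _ (adj (component_edges w1 x)) _ id).
    by move=> a b [f [wf _] fab]; exists f.
  by exists m.
exists id, id; split; [split => //|split; [split|split]].
- by split => [//|? ? _ _ //|y ?]; exists y.
- by split => [//|? ? _ _ //|y ?]; exists y.
- by rewrite image_id.
- rewrite image_id /hballe /hballv /=; apply/seteqP.
  split => e [/= [we _] He]; split => /=.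
  + split; first by apply/ww' => //; exact: he.
    by move=> u v /He [Hu Hv]; rewrite hb in Hu Hv; split; exact: sub_comp.
  + by move=> u v /He [Hu Hv]; rewrite hb in Hu Hv.
  + split; first by apply/ww' => //; apply: he; rewrite hb.
    by move=> u v /He [Hu Hv]; rewrite -hb in Hu Hv; split; exact: sub_comp.
  + by move=> u v /He [Hu Hv]; rewrite -hb in Hu Hv.
- move=> y z n xy xz; split.
    exact: component_dist ww' xy xz.
  rewrite /hballv /= hb in xy xz.
  exact: component_dist w'w xy xz.
- by move=> v xv; exact: cc'.
- move=> e He.
  have /ww' E : gballe (3 * r) x e.
    by apply: (@gballeW _ _ r) => //; rewrite leq_pmull.
  rewrite /= (asbool_equiv_eq E).
  exact: (@col_close_refl R (edge_mark K) r (Some (`[< sub_e w' e >], _))).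
Qed.

End scenery_close.

Section measurable_graphs.
Context d (Y : measurableType d) (R : realType) (K : Type) (G : graph K).
Variables (CV : pseudoMetricType R) (w : Y -> subgraph G) (c : vertex G -> Y -> CV).
Hypothesis me : forall e, measurable [set y | sub_e (w y) e].
Hypothesis cc : forall v, codable (c v).

Lemma measurable_agree (X : Y -> dgraph CV (edge_mark K)) x A :
  (forall r y y', (0 < r)%N -> agree (3 * r) x (w y) (w y') ->
    (forall v, gball r x v -> ball (c v y) r%:R^-1 (c v y')) ->
    local_close r (X y) (X y')) ->
  dgraph_borel A -> measurable (X @^-1` A).
Proof.
move=> H.
have /choice [k Hk] (rv : nat * vertex G) : exists k : Y -> nat, nat_measurable k /\
    ((0 < rv.1)%N -> forall y y', k y = k y' -> ball (c rv.2 y) rv.1%:R^-1 (c rv.2 y')).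
  case: rv => r v; case: (posnP r) => [->|r0].
    exists (fun=> 0%N); split => // n.
    by rewrite preimage_cst; case: ifP.
  by have [k mk kc] := cc v r0; exists k.
pose h r (i : edge G + vertex G) y := match i with
  | inl e => nat_of_bool `[< sub_e (w y) e >] | inr v => k (r, v) y end.
apply: (@measurable_borel _ _ _ _ _ _ h) => [r [e|v]|r r0].
- move=> [|[|n]].
  + rewrite (_ : _ @^-1` _ = ~` [set y | sub_e (w y) e]); first exact: measurableC.
    by apply/seteqP; split => y /=; case: asboolP.
  + rewrite (_ : _ @^-1` _ = [set y | sub_e (w y) e])//.
    by apply/seteqP; split => y /=; case: asboolP.
  + rewrite (_ : _ @^-1` _ = set0)//.
    by apply/seteqP; split => y /=; case: asboolP.
- by have [] := Hk (r, v).
- exists ((inl @` gballe (3 * r) x) `|` (inr @` gball r x)).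
    rewrite finite_setU; split; apply: finite_image.
      exact: finite_gballe.
    exact: finite_gball.
  move=> y y' E; apply: H => // [e xe|v xv].
    have : h r (inl e) y = h r (inl e) y' by apply: E; left; exists e.
    by rewrite /h; do 2 case: asboolP.
  have [_] := Hk (r, v); apply => //.
  by apply: (E (inr v)); right; exists v.
Qed.

Lemma measurable_scenery x A : dgraph_borel A ->
  measurable [set y | A (scenery (w y) (c^~ y) x)].
Proof.
apply: (@measurable_agree (fun y => scenery (w y) (c^~ y) x) x) => r y y' r0 ag cl.
exact: scenery_close.
Qed.

Lemma measurable_whole x A : dgraph_borel A ->
  measurable [set y | A (whole (w y) (c^~ y) x)].
Proof.
apply: (@measurable_agree (fun y => whole (w y) (c^~ y) x) x) => r y y' r0 ag cl.
exists id, id; split; [split => //|split; [split|split]].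
- by split => [//|? ? _ _ //|z ?]; exists z.
- by split => [//|? ? _ _ //|z ?]; exists z.
- by rewrite image_id.
- by rewrite image_id.
- by [].
- by move=> v xv; exact: cl.
- move=> e He.
  have /ag E : gballe (3 * r) x e.
    by apply: (@gballeW _ _ r) => //; rewrite leq_pmull.
  rewrite /= (asbool_equiv_eq E).
  exact: (@col_close_refl R (edge_mark K) r (Some (`[< sub_e (w y') e >], _))).
Qed.

End measurable_graphs.

(** * Equivariance of sceneries under automorphisms *)

Section moved.
Variables (K : Type) (G : graph K) (CV : Type).

(** The pointwise form of [w' = aut_image a w], which avoids equality of records carrying proofs. *)
Record moved (a : automorphism G) (w w' : subgraph G) : Prop := Moved {
  moved_v : forall x, sub_v w x <-> sub_v w' (autv a x);
  moved_e : forall e, sub_e w e <-> sub_e w' (aute a e) }.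

Lemma moved_image a w : moved a w (aut_image a w).
Proof.
split=> x; split => [wx|].
- by exists x.
- by case=> y wy /(bij_inj (autv_bij a)) <-.
- by exists x.
- by case=> y wy /(bij_inj (aute_bij a)) <-.
Qed.

Variables (a : automorphism G) (w w' : subgraph G).
Hypothesis ww' : moved a w w'.

Lemma iso_whole (c c' : vertex G -> CV) x : (forall v, c' (autv a v) = c v) ->
  @iso _ _ (whole w c x) (whole w' c' (autv a x)) (autv a) (aute a).
Proof.
move=> cc'; split => //.
- exact: (autv_bij a).
- exact: (aute_bij a).
- exact: (aut_joins a).
- by move=> v /=; rewrite cc'.
- move=> e /=; rewrite aut_ecol; congr (Some (_, _)); apply: asbool_equiv_eq.
  by have := moved_e ww' e; tauto.
Qed.

Lemma moved_adj x y : adj (sub_e w) x y <-> adj (sub_e w') (autv a x) (autv a y).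
Proof.
pose c (v : vertex G) := tt.
have I : @iso _ _ (whole w c x) (whole w' c (autv a x)) (autv a) (aute a).
  split => //.
  - exact: (autv_bij a).
  - exact: (aute_bij a).
  - exact: (aut_joins a).
  - move=> e /=; rewrite aut_ecol; congr (Some (_, _)); apply: asbool_equiv_eq.
    by have := moved_e ww' e; tauto.
by apply: (iso_adj I) => e; exact: moved_e.
Qed.

Lemma moved_component x y : component w x y <-> component w' (autv a x) (autv a y).
Proof.
split; first by apply: connected_map => u v; rewrite moved_adj.
have [b ab ba] := autv_bij a.
rewrite -{2}(ab x) -{2}(ab y); apply: connected_map => u v.
by rewrite moved_adj !ba.
Qed.

Lemma moved_component_edges x e :
  component_edges w x e <-> component_edges w' (autv a x) (aute a e).
Proof.
have [b ab ba] := autv_bij a.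
split=> -[/(moved_e ww') we H]; split => // u v.
  by rewrite -(ba u) -(ba v) -aut_joins => /H; rewrite !moved_component.
by rewrite aut_joins => /H; rewrite !moved_component.
Qed.

Lemma iso_scenery (c c' : vertex G -> CV) x : (forall v, c' (autv a v) = c v) ->
  @iso _ _ (scenery w c x) (scenery w' c' (autv a x)) (autv a) (aute a).
Proof.
move=> cc'; split => //.
- exact: (autv_bij a).
- exact: (aute_bij a).
- exact: (aut_joins a).
- exact: moved_component.
- exact: moved_component_edges.
- by move=> v /=; rewrite cc'.
- move=> e /=; rewrite aut_ecol; congr (Some (_, _)); apply: asbool_equiv_eq.
  by have := moved_e ww' e; tauto.
Qed.

End moved.

Lemma iso_scenery_reroot (K : Type) (G : graph K) (CV : Type) (w : subgraph G)
    (c : vertex G -> CV) x y (H : component w x y) :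
  @iso _ _ (@reroot _ _ (scenery w c x) y H) (scenery w c y) id id.
Proof.
split => //; do ?by exists id.
  by move=> v /=; rewrite (component_eq H).
by move=> v /=; rewrite (component_edges_eq H).
Qed.

(** The complement of the point [f X] is open, so its preimage is Borel and hence invariant under
    isomorphism. This is what makes the decoration [fiid] equivariant. *)
Lemma borel_fun_iso (R : realType) (CV CE : pseudoMetricType R) (Xi : metricType R)
    (f : dgraph CV CE -> Xi) X Y p q : borel_fun f -> @iso _ _ X Y p q -> f X = f Y.
Proof.
move=> bf I; apply: contrapT => nfXY.
have oU : open (~` [set f X]).
  apply: closed_openC; apply: accessible_closed_set1.
  by apply: hausdorff_accessible; exact: metric_hausdorff.
have [_ H] := borel_iso (bf _ oU) I.
by apply: H => //= E; apply: nfXY.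
Qed.

Lemma metric_ball_open (R : realType) (M : metricType R) (m : M) e :
  open (ball m e).
Proof.
rewrite openE => y; rewrite ballEmdist /= => my.
apply/nbhs_ballP; exists (e - mdist m y); first by rewrite /= subr_gt0.
move=> z; rewrite ballEmdist /= ltrBrDl; apply: le_lt_trans.
exact: metric_triangle.
Qed.

Section decorated_event.
Variables (R : realType) (K : Type) (G : graph K) (Xi : metricType R).
Variables (f : dgraph (bool * R)%type (edge_mark K) -> Xi).
Hypothesis bf : @borel_fun R (bool * R)%type (edge_mark K) Xi f.
Variable A : set (dgraph (bool * Xi)%type (edge_mark K)).
Hypothesis bA : @dgraph_borel R (bool * Xi)%type (edge_mark K) A.

Definition decorated (w : subgraph G) (l : vertex G -> R) x :
    dgraph (bool * Xi)%type (edge_mark K) :=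
  scenery w (fun v => (`[< sub_v w v >], fiid f w l v)) x.

Lemma decorated_moved a w w' l l' x : moved a w w' ->
  (forall v, l' (autv a v) = l v) ->
  A (decorated w l x) <-> A (decorated w' l' (autv a x)).
Proof.
move=> ww' ll'; apply: (borel_iso bA); apply: iso_scenery => // v.
have E : `[< sub_v w' (autv a v) >] = `[< sub_v w v >].
  by apply: asbool_equiv_eq; have := moved_v ww' v; tauto.
congr (_, _) => //; apply/esym/borel_fun_iso => //.
apply: (@iso_whole _ _ _ a) => // u; congr (_, _) => //.
by apply: asbool_equiv_eq; have := moved_v ww' u; tauto.
Qed.

Lemma decorated_component w l x y : root_invariant A -> component w x y ->
  A (decorated w l x) <-> A (decorated w l y).
Proof.
move=> rA.
suff H u v : component w u v -> A (decorated w l u) -> A (decorated w l v).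
  by move=> xy; split; apply: H => //; exact: component_sym.
move=> uv; pose uv' : hv (decorated w l u) v := uv.
move=> /(rA _ _ uv').
by apply: (borel_iso bA (iso_scenery_reroot _ uv)).1.
Qed.

Hypothesis sepXi : exists2 D : set Xi, countable D & dense D.

(** There are two layers: the colour of a vertex in the scenery is itself a Borel function of the
    whole labelled graph. Separability of [Xi] makes these colours codable, and the rationals do the
    same for the labels. *)
Lemma measurable_decorated d (Y : measurableType d) (w : Y -> subgraph G)
    (l : Y -> vertex G -> R) x :
  (forall v, measurable [set y | sub_v (w y) v]) ->
  (forall e, measurable [set y | sub_e (w y) e]) ->
  (forall v, measurable_fun setT (l^~ v)) ->
  measurable [set y | A (decorated (w y) (l y) x)].
Proof.
move=> mv me ml.
have cv v : codable (fun y => `[< sub_v (w y) v >]).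
  apply: codable_bool; rewrite (_ : [set _ | _] = [set y | sub_v (w y) v])//.
  by apply/seteqP; split => y /=; case: asboolP.
apply: (@measurable_scenery _ Y R K G (bool * Xi)%type w
  (fun v y => (`[< sub_v (w y) v >], fiid f (w y) (l y) v)) me _ x _ bA) => v.
apply: codable_pair => //.
have [D cD dD] := sepXi; apply: codable_dense cD _ _ => [u e e0|m e e0].
  have [m [/= b Dm]] : ball u e `&` D !=set0.
    apply: dD; [exists u; exact: ballxx|exact: metric_ball_open].
  by exists m => //; exact: ball_sym.
have oB : open (ball m e) by exact: metric_ball_open.
apply: (@measurable_whole _ Y R K G (bool * R)%type w
  (fun v y => (`[< sub_v (w y) v >], l y v)) me _ v _ (bf oB)) => u.
apply: codable_pair => //.
apply: (@codable_dense _ _ _ _ (@ratr R @` setT)).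
- by apply: sub_countable (card_image_le _ _) _; exact: countableP.
- move=> z a a0; have [p [b Dp]] : ball z a `&` (@ratr R @` setT) !=set0.
    by apply: dense_rat; [exists z; exact: ballxx|exact: ball_open].
  by exists p => //; exact: ball_sym.
- move=> z a a0; rewrite -[X in measurable X]setTI.
  by apply: (ml u) => //; exact: (open_measurable (ball_open z a)).
Qed.

End decorated_event.

(** * Random labels *)

Section measure_facts.
Context d (Y : measurableType d) (R : realType) (mu : {finite_measure set Y -> \bar R}).

Lemma measure_cover (A B C : set Y) : measurable A -> measurable B -> measurable C ->
  A `<=` B `|` C -> (mu A <= mu B + mu C)%E.
Proof.
move=> mA mB mC ABC; apply: le_trans (measureU2 _ mB mC).
by apply: le_measure => //; rewrite inE//; exact: measurableU.
Qed.

Lemma measure_bigcup_tail (F : nat -> set Y) (e : R) : (forall n, measurable (F n)) ->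
  0 < e -> exists N, (mu (\bigcup_n F n `\` \bigcup_(i < N) F i) < e%:E)%E.
Proof.
move=> mF e0; pose T N := \bigcup_n F n `\` \bigcup_(i < N) F i.
have mT N : measurable (T N).
  by apply: measurableD; [exact: bigcupT_measurable|exact: bigcup_measurable].
have T0 : \bigcap_N T N = set0.
  rewrite -subset0 => y HT; have [[n _ Fn] _] := HT 0%N I.
  by have [_] := HT n.+1 I; apply; exists n => /=.
have : mu \o T @ \oo --> mu (\bigcap_N T N).
  apply: nonincreasing_cvg_mu => //.
  - by rewrite ltey_eq fin_num_measure.
  - exact: bigcapT_measurable.
  - move=> m n mn; apply/subsetPset; apply: setDS => y [i /= im Fi].
    by exists i => //=; exact: leq_trans mn.
rewrite T0 measure0 => /fine_cvgP [_].
move=> /cvgrPdist_lt /(_ _ e0) [N _ /(_ N (leqnn N)) /=].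
rewrite sub0r normrN ger0_norm ?fine_ge0// => H; exists N.
by rewrite -(fineK (fin_num_measure mu _ (mT N))) lte_fin.
Qed.

End measure_facts.

Section labels.
Variables (V : Type) (R : realType).

(** Rational thresholds make the generating family countable when [V] is, so that the finite Boolean
    combinations below can be enumerated. *)
Definition label_gen : set (set (V -> R)) :=
  [set A | exists v (q : rat), A = [set l | ratr q < l v]].

Definition labels := [the measurableType _ of g_sigma_algebraType label_gen].

Lemma measurable_coord v : measurable_fun setT (fun l : labels => l v).
Proof.
move=> mT; apply: (measurability _ (RGenOInfty.measurableE R)) => //.
move=> _ [_ [x ->] <-]; rewrite setTI.
rewrite (_ : _ @^-1` _ = \bigcup_(q in [set q : rat | x < ratr q])
    [set l : labels | ratr q < l v]).
  apply: bigcup_countable_measurable => [|q]; first exact: countableP.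
  by apply: sub_sigma_algebra; exists v, q.
apply/seteqP; split => [l /=|l [q /= xq ql]].
  rewrite in_itv /= andbT => /rat_in_itvoo [q]; rewrite in_itv /= => /andP [xq ql].
  by exists q.
by rewrite /= in_itv /= andbT; exact: lt_trans ql.
Qed.

Lemma measurable_labels d (Y : measurableType d) (F : Y -> labels) :
  (forall v, measurable_fun setT (fun y => F y v)) -> measurable_fun setT F.
Proof.
move=> mF mT; apply: (@measurability _ _ Y labels setT F label_gen erefl _ mT).
move=> _ [_ [v [q ->]] <-].
have := mF v measurableT `]ratr q, +oo[%classic (measurable_itv _).
congr (measurable (_ `&` _)); apply/seteqP.
by split => y /=; rewrite in_itv /= andbT.
Qed.

Definition cylinder (s : seq {classic V}) (B : V -> set R) : set labels :=
  [set l | forall v, v \in s -> B v (l v)].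

Lemma measurable_cylinder s B : (forall v, measurable (B v)) ->
  measurable (cylinder s B).
Proof.
move=> mB; rewrite (_ : cylinder s B =
    \bigcap_(v in [set v | v \in s]) [set l : labels | B v (l v)]).
  apply: fin_bigcap_measurable; first by apply/finite_seqP; exists s.
  move=> v _; have := measurable_coord v measurableT (mB v).
  by rewrite setTI.
by apply/seteqP; split.
Qed.

Definition cylinders : set (set labels) :=
  [set A | exists s B, [/\ uniq s, forall v, measurable (B v) & A = cylinder s B]].

Lemma cylindersI : setI_closed cylinders.
Proof.
move=> _ _ [s [B [us mB ->]]] [s' [B' [us' mB' ->]]].
(* Outside its list of coordinates a cylinder imposes no condition, hence the default [setT]; both
   conditions can then be imposed on the concatenated list. *)
pose C (t : seq {classic V}) (D : V -> set R) v := if (v : {classic V}) \in t then D v else setT.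
exists (undup (s ++ s')), (fun v => C s B v `&` C s' B' v); split.
- exact: undup_uniq.
- by move=> v; apply: measurableI; rewrite /C; case: ifP.
- apply/seteqP; split => l.
    move=> [H H'] v; rewrite mem_undup mem_cat /C => vs.
    by split; case: ifP => // ?; [exact: H|exact: H'].
  move=> H; split => v vs.
    by have := H v; rewrite mem_undup mem_cat /C vs /= => /(_ isT) [].
  by have := H v; rewrite mem_undup mem_cat /C vs orbT /= => /(_ isT) [].
Qed.

Lemma labels_eq (m1 m2 : probability labels R) :
  (forall A, cylinders A -> m1 A = m2 A) -> forall A, measurable A -> m1 A = m2 A.
Proof.
move=> H A mA.
have cT : cylinders setT.
  exists [::], (fun=> setT); split => //; apply/seteqP; split => //.
apply: (@g_sigma_algebra_measure_unique _ R _ cylinders _ (fun=> setT)) => //.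
- by move=> _ [s [B [_ mB ->]]]; exact: measurable_cylinder.
- by rewrite bigcup_const//; exists 0%N.
- exact: cylindersI.
- by move=> _; rewrite ltey_eq fin_num_measure.
suff H' : label_gen `<=` cylinders by exact: (sub_sigma_algebra2 H' mA).
move=> _ [v [q ->]].
exists [:: v : {classic V}], (fun=> `]ratr q, +oo[%classic); split => //.
apply/seteqP; split => l /= Hl.
  by move=> u; rewrite inE => /eqP ->; rewrite /= in_itv /= andbT.
by have := Hl v (mem_head _ _); rewrite /= in_itv /= andbT.
Qed.

Definition iid_law (m : set R -> \bar R) (nu : probability labels R) :=
  forall s B, uniq s -> (forall v, measurable (B v)) ->
  nu (cylinder s B) = (\prod_(v <- s) m (B v))%E.

Lemma measurable_reindex (phi : V -> V) :
  measurable_fun setT (fun l : labels => (l \o phi : labels)).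
Proof. by apply: measurable_labels => v; exact: measurable_coord. Qed.

Lemma iid_reindex m nu (phi : V -> V) (A : set labels) : iid_law m nu -> bijective phi ->
  measurable A -> nu [set l : labels | A (l \o phi)] = nu A.
Proof.
move=> Hnu [psi phiK psiK] mA.
pose X : {mfun labels >-> labels} := mfun_Sub (mem_set (measurable_reindex phi)).
suff E C : cylinders C -> distribution nu X C = nu C.
  exact: (@labels_eq (distribution nu X) nu E A mA).
move=> [s [B [us mB ->]]].
rewrite [RHS]Hnu// /distribution /pushforward.
transitivity (nu (cylinder (map phi s : seq {classic V}) (B \o psi))).
  congr (nu _); apply/seteqP; split => l /= H v.
    by move=> /(@mapP {classic V} {classic V}) [u us' ->] /=; rewrite phiK; exact: H.
  move=> vs; have := H (phi v); rewrite /= phiK; apply.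
  exact: (@map_f {classic V} {classic V}).
have us' : uniq (map phi s : seq {classic V}).
  by rewrite (@map_inj_uniq {classic V} {classic V})//; exact: can_inj phiK.
rewrite (Hnu _ _ us' (fun v => mB (psi v))).
by rewrite big_map; apply: eq_bigr => v _ /=; rewrite phiK.
Qed.

Definition depends_on (J : set V) (A : set labels) :=
  forall l l' : labels, (forall v, J v -> l v = l' v) -> A l -> A l'.

(** Take two independent labellings and glue the first on [J] to the second off [J]. The result has
    law [nu] again, while [A] sees only the first labelling and [B] only the second. *)
Lemma iid_indep m nu J A B : iid_law m nu -> measurable A -> measurable B ->
  depends_on J A -> depends_on (~` J) B -> nu (A `&` B) = (nu A * nu B)%E.
Proof.
move=> Hnu mA mB dA dB.
pose mix (ll : labels * labels) : labels :=
  fun v => if v \in J then ll.1 v else ll.2 v.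
have mmix : measurable_fun setT mix.
  apply: measurable_labels => v; rewrite /mix; case: (v \in J).
    exact: (measurableT_comp (measurable_coord v) measurable_fst).
  exact: (measurableT_comp (measurable_coord v) measurable_snd).
pose X : {mfun (labels * labels)%type >-> labels} := mfun_Sub (mem_set mmix).
have E C : measurable C -> distribution (nu \x nu)%E X C = nu C.
  suff H D : cylinders D -> distribution (nu \x nu)%E X D = nu D.
    exact: (@labels_eq (distribution (nu \x nu)%E X) nu H C).
  move=> [s [D' [us mD ->]]] {C}.
  rewrite /distribution /pushforward.
  transitivity ((nu \x nu)%E (cylinder [seq v <- s | v \in J] D' `*`
      cylinder [seq v <- s | v \notin J] D')).
    congr (_ _); apply/seteqP; split => -[l l'] /=.
      move=> H; split => v; rewrite mem_filter => /andP [vJ vs]; have := H v vs;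
        by rewrite /mix ?vJ ?(negbTE vJ).
    by move=> [H H'] v vs; rewrite /mix; case: ifPn => vJ /=;
      [apply: H|apply: H']; rewrite mem_filter vJ.
  rewrite product_measure1E//; try exact: measurable_cylinder.
  have HQ (Q : pred V) : nu (cylinder [seq v <- s | Q v] D') =
      (\prod_(v <- s | Q v) m (D' v))%E.
    have us' : uniq ([seq v <- s | Q v] : seq {classic V}) by exact: filter_uniq.
    by rewrite (Hnu _ _ us' mD) big_filter.
  rewrite (Hnu _ _ us mD) [RHS](bigID (fun v => v \in J)) /=.
  by congr (_ * _)%E; [exact: (HQ (fun v => v \in J))|exact: (HQ (fun v => v \notin J))].
rewrite -E; last exact: measurableI.
rewrite -product_measure1E// /distribution /pushforward; congr (_ _).
apply/seteqP; split => -[l l'] /=.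
  move=> [Al Bl]; split; [apply: dA Al|apply: dB Bl] => v Jv; rewrite /mix.
    by rewrite mem_set.
  by rewrite memNset.
move=> [Al Bl]; split; [apply: dA Al|apply: dB Bl] => v Jv; rewrite /mix.
  by rewrite mem_set.
by rewrite memNset.
Qed.

End labels.

(** * Approximation by countably many local events *)

Section formulas.
Variables (V : Type) (R : realType) (e : nat -> V).
Hypothesis esurj : forall v, exists n, e n = v.

(* Finite Boolean combinations of the events [ratr q < l (e i)], coded by trees
   so as to be countably many; the inner nodes are NOR gates. *)
Fixpoint sem (t : GenTree.tree (nat * rat)) (l : V -> R) : bool :=
  match t with
  | GenTree.Leaf p => ratr p.2 < l (e p.1)
  | GenTree.Node _ ts => ~~ has (fun t => sem t l) ts
  end.

Definition semset t : set (labels V R) := [set l | sem t l].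

Definition good_form t :=
  measurable (semset t) /\ exists2 J, finite_set J & depends_on J (semset t).

Let nor t1 t2 : GenTree.tree (nat * rat) := GenTree.Node 0 [:: t1; t2].

Lemma semset_nor t1 t2 : semset (nor t1 t2) = ~` (semset t1 `|` semset t2).
Proof.
apply/seteqP; split => l; rewrite /semset /= orbF.
  by move=> /norP [/negP ? /negP ?] [].
by move=> H; apply/negP => /orP H'; apply: H.
Qed.

Lemma depends_onC J A : @depends_on V R J A -> depends_on J (~` A).
Proof. by move=> dA l l' ll' nA A'; apply: nA; apply: dA A' => v /ll' ->. Qed.

Lemma good_nor t1 t2 : good_form t1 -> good_form t2 -> good_form (nor t1 t2).
Proof.
move=> [m1 [J1 f1 d1]] [m2 [J2 f2 d2]]; rewrite /good_form semset_nor; split.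
  by apply: measurableC; exact: measurableU.
exists (J1 `|` J2); first by rewrite finite_setU.
apply: depends_onC => l l' ll' [A|A].
  by left; apply: d1 A => v Jv; apply: ll'; left.
by right; apply: d2 A => v Jv; apply: ll'; right.
Qed.

(** The approximable events form a sigma-algebra: complements and finite unions are made with NOR
    gates, and a countable union is truncated first, half of the error being spent on the tail. *)
Lemma formula_approx (nu : probability (labels V R) R) A (eta : R) :
  measurable A -> 0 < eta ->
  exists2 t, good_form t & (nu (A `+` semset t) <= eta%:E)%E.
Proof.
move=> mA.
pose D : set (set (labels V R)) := [set A | measurable A /\
  forall eta : R, 0 < eta ->
  exists2 t, good_form t & (nu (A `+` semset t) <= eta%:E)%E].
suff : D A by case=> _; exact.
have mY (B C : set (labels V R)) : measurable B -> measurable C -> measurable (B `+` C).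
  by move=> mB mC; apply: measurableU; exact: measurableD.
have DE B t : good_form t -> B = semset t -> D B.
  move=> gt ->; split => [|r r0]; first by case: gt.
  by exists t => //; rewrite setYK measure0 lee_fin ltW.
have DC B : D B -> D (~` B).
  case=> mB HB; split => [|r r0]; first exact: measurableC.
  have [t gt Ht] := HB _ r0; exists (nor t t); first exact: good_nor.
  rewrite semset_nor setUid; apply: le_trans Ht; rewrite le_eqVlt; apply/orP; left.
  apply/eqP; congr (nu _); apply/seteqP.
  by split => l /= [[? ?]|[? ?]]; [right|left|right|left]; split => //; exact: contrapT.
have DU B C : D B -> D C -> D (B `|` C).
  move=> [mB HB] [mC HC]; split => [|r r0]; first exact: measurableU.
  have r20 : 0 < r / 2 by rewrite divr_gt0.
  have [t gt Ht] := HB _ r20; have [u gu Hu] := HC _ r20.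
  (* A gate with both inputs equal is a negation, so this is the disjunction of [t] and [u]. *)
  exists (nor (nor t u) (nor t u)); first by do 2 apply: good_nor => //; exact: good_nor.
  rewrite semset_nor setUid semset_nor setCK.
  rewrite [r]splitr EFinD; apply: le_trans (leeD Ht Hu).
  apply: measure_cover.
  - by apply: mY; apply: measurableU => //; [case: gt|case: gu].
  - by apply: mY => //; case: gt.
  - by apply: mY => //; case: gu.
  - by move=> l /=; tauto.
have D0 : D set0.
  (* A gate without inputs is true. *)
  have gT : good_form (GenTree.Node 0 [::]).
    rewrite /good_form (_ : semset _ = setT)//; last by apply/seteqP; split.
    by split => //; exists set0.
  rewrite -setCT; apply: DC; apply: (DE _ (GenTree.Node 0 [::])) => //.
  by apply/seteqP; split.
have DB (F : (set (labels V R))^nat) : (forall n, D (F n)) -> D (\bigcup_n F n).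
  move=> DF.
  have mF n : measurable (F n) by case: (DF n).
  have DN N : D (\bigcup_(i < N) F i).
    elim: N => [|N IH]; first by rewrite II0 bigcup_set0.
    rewrite (_ : \bigcup_(i < N.+1) _ = (\bigcup_(i < N) F i) `|` F N); first exact: DU.
    by rewrite IIS bigcup_setU bigcup_set1.
  split => [|r r0]; first exact: bigcupT_measurable.
  have r20 : 0 < r / 2 by rewrite divr_gt0.
  have [N HN] := measure_bigcup_tail nu mF r20.
  have [mFN /(_ _ r20) [t gt Ht]] := DN N; exists t => //.
  rewrite [r]splitr EFinD; apply: le_trans (leeD (ltW HN) Ht).
  apply: measure_cover.
  + by apply: mY; [exact: bigcupT_measurable|case: gt].
  + by apply: measurableD => //; exact: bigcupT_measurable.
  + by apply: mY => //; case: gt.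
  + move=> l [[Fl nt]|[tl nF]].
      have [|] := pselect ((\bigcup_(i < N) F i) l); last by left.
      by right; left.
    by right; right; split => // -[i _ Fi]; apply: nF; exists i.
apply: (@smallest_sub _ (sigma_algebra setT) (@label_gen V R) D _ _ A mA).
  by split => // B DB'; rewrite setTD; exact: DC.
move=> _ [v [q ->]]; have [n nv] := esurj v.
have E : semset (GenTree.Leaf (n, q)) = [set l | ratr q < l v].
  by apply/seteqP; split => l; rewrite /semset /= nv.
apply: (DE _ (GenTree.Leaf (n, q))); last by rewrite E.
rewrite /good_form E; split; first by apply: sub_sigma_algebra; exists v, q.
by exists [set v] => // l l' ll' /=; rewrite (ll' v).
Qed.

End formulas.

(** * Mass transport *)

Section percolations.
Variables (K : Type) (G : graph K).

Definition empty_subgraph : subgraph G :=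
  @Subgraph K G set0 set0 (fun e x y (H : False) _ => match H with end).

HB.instance Definition _ := gen_eqMixin (subgraph G).
HB.instance Definition _ := gen_choiceMixin (subgraph G).
HB.instance Definition _ := isPointed.Build (subgraph G) empty_subgraph.

Definition subgraph_gen : set (set (subgraph G)) :=
  [set A | (exists v, A = [set w | sub_v w v]) \/
           (exists e, A = [set w | sub_e w e])].

Definition percol := [the measurableType _ of g_sigma_algebraType subgraph_gen].

Lemma measurable_sub_v v : measurable [set w : percol | sub_v w v].
Proof. by apply: sub_sigma_algebra; left; exists v. Qed.

Lemma measurable_sub_e e : measurable [set w : percol | sub_e w e].
Proof. by apply: sub_sigma_algebra; right; exists e. Qed.

Lemma measurable_component x y : measurable [set w : percol | component w x y].
Proof.
have cV := countable_vertex x; have cE := countable_edge x.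
have madj u v : measurable [set w : percol | adj (sub_e w) u v].
  rewrite (_ : [set _ | _] = \bigcup_(e in [set e | joins e u v \/ joins e v u])
      [set w : percol | sub_e w e]).
    by apply: bigcup_countable_measurable => // e; exact: measurable_sub_e.
  by apply/seteqP; split => [w [e we euv]|w [e euv we]]; exists e.
have mwalk n u v : measurable [set w : percol | walk (adj (sub_e w)) n u v].
  elim: n u => [|n IH] u /=.
    have [->|uv] := pselect (u = v).
      by rewrite (_ : [set _ | _] = setT)//; apply/seteqP; split.
    by rewrite (_ : [set _ | _] = set0)//; apply/seteqP; split.
  rewrite (_ : [set _ | _] = \bigcup_z ([set w : percol | adj (sub_e w) u z] `&`
      [set w : percol | walk (adj (sub_e w)) n z v])).
    by apply: bigcup_countable_measurable => // z; exact: measurableI.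
  by apply/seteqP; split => [w [z uz zv]|w [z _ [uz zv]]]; exists z.
rewrite (_ : [set _ | _] = \bigcup_n [set w : percol | walk (adj (sub_e w)) n x y]).
  exact: bigcupT_measurable.
by apply/seteqP; split => [w [n ?]|w [n _ ?]]; exists n.
Qed.

End percolations.

(* [shift x] is meant to be the left translation taking a fixed vertex to [x],
   and [shift_inv x] the vertex which it takes to that vertex. *)
Record shifts (K : Type) (G : graph K) (o : vertex G) := Shifts {
  shift : vertex G -> automorphism G;
  shift_inv : vertex G -> vertex G;
  shift_root : forall x, autv (shift x) o = x;
  shift_invK : forall x, autv (shift x) (shift_inv x) = o;
  shift_inv_inj : injective shift_inv;
  shift_comp : forall x y v,
    autv (shift (autv (shift x) y)) v = autv (shift x) (autv (shift y) v);
  shift_free : forall v, injective (fun x => autv (shift x) v) }.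

Section mass_transport.
Variables (R : realType) (K : Type) (G : graph K) (o : vertex G) (tau : shifts o).
Variable mu : probability (percol G) R.
Hypothesis inv : forall (a : automorphism G) (A : set (percol G)), measurable A ->
  mu [set w : percol G | A (aut_image a w)] = mu A.
Variable e : nat -> vertex G.
Hypothesis eb : bijective e.
Variable Q : percol G -> vertex G -> Prop.
Hypothesis mQ : forall x, measurable [set w | Q w x].
Hypothesis Qequiv : forall y w x,
  Q (aut_image (shift tau y) w) (autv (shift tau y) x) <-> Q w x.

(** The bound is witnessed by a list of indices and not by a cardinal, so that measurability is a
    countable union over lists. *)
Definition few n (w : percol G) x := exists2 s : seq nat, (size s <= n)%N &
  forall k, component w x (e k) -> Q w (e k) -> k \in s.

Lemma measurable_few n x : measurable [set w | few n w x].
Proof.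
rewrite (_ : [set _ | _] = \bigcup_(s in [set s : seq nat | (size s <= n)%N])
    \bigcap_(k in [set k | k \notin s])
      ~` ([set w : percol G | component w x (e k)] `&` [set w | Q w (e k)])).
  apply: bigcup_countable_measurable => [|s]; first exact: countableP.
  apply: bigcap_measurableType => k _; apply: measurableC; apply: measurableI => //.
  exact: measurable_component.
apply/seteqP; split => w [s sn H]; exists s => //.
  by move=> k /= ks [xk wk]; move: ks; rewrite H.
move=> k xk wk; apply: contrapT => /negP ks.
by apply: (H k ks).
Qed.

Lemma few_component n w x y : component w x y -> few n w x -> few n w y.
Proof. by move=> xy [s sn H]; exists s => // k; rewrite (component_eq xy); exact: H. Qed.

Lemma few_image n (a : automorphism G) (w : percol G) x :
  (forall x, Q (aut_image a w) (autv a x) <-> Q w x) ->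
  few n (aut_image a w) (autv a x) <-> few n w x.
Proof.
move=> Qa; have mw := moved_image a w; have [e' ee' e'e] := eb.
have [b ab ba] := autv_bij a.
split=> -[s sn H].
  exists [seq e' (b (e k)) | k <- s]; first by rewrite size_map.
  move=> k /(moved_component mw) xk /Qa wk; apply/mapP.
  exists (e' (autv a (e k))); last by rewrite e'e ab ee'.
  by apply: H; rewrite e'e.
exists [seq e' (autv a (e k)) | k <- s]; first by rewrite size_map.
move=> k; rewrite -(ba (e k)) -(moved_component mw) Qa => xk wk; apply/mapP.
exists (e' (b (e k))); last by rewrite e'e ba ee'.
by apply: H; rewrite e'e.
Qed.

(** The sum is the expected number of indices [k < m] for which [y k] is a vertex of [Q] in the
    component of [o], on the event that there are at most [n] such vertices. The enumeration [y] is
    arbitrary because it will be composed with [shift_inv]. *)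
Lemma few_sum n m (y : nat -> vertex G) : injective y ->
  (\sum_(0 <= k < m) mu [set w | [/\ few n w o, component w o (y k) & Q w (y k)]]
   <= n%:R%:E)%E.
Proof.
move=> yinj; pose B k := [set w | [/\ few n w o, component w o (y k) & Q w (y k)]].
have mB k : measurable (B k).
  rewrite (_ : B k = [set w | few n w o] `&` [set w : percol G | component w o (y k)]
      `&` [set w | Q w (y k)]); last by apply/seteqP; split => [w []|w [[]]].
  apply: measurableI => //; apply: measurableI; first exact: measurable_few.
  exact: measurable_component.
have [e' ee' e'e] := eb.
rewrite (_ : \sum_(0 <= k < m) mu _ =
    \int[mu]_(w in setT) \sum_(0 <= k < m) (\1_(B k) w)%:E)%E; last first.
  rewrite ge0_integral_sum//.
  - by apply: eq_bigr => k _; rewrite integral_indic// setIT.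
  - by move=> k; apply/measurable_EFinP; exact: measurable_indic.
rewrite (_ : n%:R%:E = \int[mu]_(w in setT) (cst n%:R%:E) w)%E; last first.
  by rewrite integral_cst//= probability_setT mule1.
apply: ge0_le_integral => //.
- by move=> w _; apply: sume_ge0 => k _; rewrite lee_fin.
- by apply: emeasurable_sum => k; apply/measurable_EFinP; exact: measurable_indic.
move=> w _; rewrite sumEFin lee_fin /cst.
have [[s sn Hs]|nf] := pselect (few n w o); last first.
  rewrite big1 ?ler0n// => k _; rewrite indicE memNset// => -[].
  by move=> f; case: nf.
rewrite (_ : \sum_(0 <= k < m) _ = (count (fun k => w \in B k) (iota 0 m))%:R); last first.
  rewrite /index_iota subn0 -sum1_count natr_sum [RHS]big_mkcond /=.
  by apply: eq_bigr => k _; rewrite indicE; case: (w \in B k).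
rewrite ler_nat; apply: leq_trans sn; rewrite -size_filter.
rewrite -(size_map (fun k => e' (y k))); apply: uniq_leq_size.
  rewrite map_inj_uniq; first by rewrite filter_uniq// iota_uniq.
  by move=> k l /(can_inj e'e) /yinj.
move=> _x /mapP [k]; rewrite mem_filter => /andP [/set_mem [_ ok wk] _] -> {_x}.
by apply: Hs; rewrite e'e.
Qed.

Lemma infinite_component_unbounded (C : set (vertex G)) N : infinite_set C ->
  exists2 k, (N <= k)%N & C (e k).
Proof.
move=> iC; apply: contrapT => H; apply: iC.
have [e' ee' e'e] := eb.
apply: (@sub_finite_set _ _ (e @` `I_N)); last exact/finite_image/finite_II.
move=> v Cv; exists (e' v) => //=; rewrite ltnNge; apply/negP => Nv.
by apply: H; exists (e' v); rewrite // e'e.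
Qed.

(* Each vertex of [Q] sends mass one to each vertex of its component: at most [n]
   is received on the average, whereas infinitely much is sent. *)
Lemma few_negligible n :
  mu.-negligible [set w | [/\ few n w o, infinite_set (component w o) & Q w o]].
Proof.
pose F k := [set w : percol G | [/\ few n w o, component w o (e k) & Q w o]].
have mF k : measurable (F k).
  rewrite (_ : F k = [set w | few n w o] `&` [set w : percol G | component w o (e k)]
      `&` [set w | Q w o]); last by apply/seteqP; split => [w []|w [[]]].
  apply: measurableI => //; apply: measurableI; first exact: measurable_few.
  exact: measurable_component.
(* Borel-Cantelli: an infinite component contains [e k] for infinitely many [k], so the event lies
   in the limsup of the [F k], whose probabilities will be shown to be summable. *)
exists (lim_sup_set F); split.
- apply: bigcapT_measurable => i; exact: bigcup_measurable.
- apply: lim_sup_set_cvg0 => //; apply: (@le_lt_trans _ _ (n%:R%:E : \bar R)%E); last exact: ltry.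
  apply: lime_le; first by apply: is_cvg_nneseries => *; exact: measure_ge0.
  apply: nearW => m.
  (* Translating by [shift tau (e k)] turns the mass sent by [o] to [e k] into the mass received by
     [o] from [shift_inv tau (e k)]. *)
  have yinj : injective (shift_inv tau \o e).
    by apply: inj_comp; [exact: shift_inv_inj|exact: bij_inj].
  apply: le_trans (few_sum n m yinj); rewrite le_eqVlt; apply/orP; left; apply/eqP.
  apply: eq_bigr => k _.
  transitivity (mu [set w : percol G | F k (aut_image (shift tau (e k)) w)]).
    exact/esym/inv.
  congr (mu _); apply/seteqP; pose a := shift tau (e k).
  have ao : autv a (shift_inv tau (e k)) = o by exact: shift_invK.
  have ak : autv a o = e k by exact: shift_root.
  have c1 w : component (aut_image a w) o (e k) <-> component w (shift_inv tau (e k)) o.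
    by have := moved_component (moved_image a w) (shift_inv tau (e k)) o; rewrite ao ak; tauto.
  have c2 w : Q (aut_image a w) o <-> Q w (shift_inv tau (e k)).
    by have := Qequiv (e k) w (shift_inv tau (e k)); rewrite -/a ao; tauto.
  have c3 w : few n (aut_image a w) o <-> few n w (shift_inv tau (e k)).
    by have := few_image n (shift_inv tau (e k)) (Qequiv (e k) w); rewrite -/a ao; tauto.
  split => w [].
    move=> /c3 f /c1 c /c2 q.
    by split => //; [exact: few_component f|exact: component_sym].
  move=> f c q; split; [apply/c3|apply/c1|exact/c2].
    exact: few_component f.
  exact: component_sym.
- move=> w [f iw q] N _.
  by have [k Nk ok] := infinite_component_unbounded N iw; exists k.
Qed.

(** If the intersection is finite then [few n] holds with [n] its size, so the exceptional event is
    covered by countably many negligible ones. *)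
Lemma infinitely_many_in_component :
  {ae mu, forall w : percol G, infinite_set (component w o) -> Q w o ->
    infinite_set (component w o `&` Q w)}.
Proof.
rewrite /almost_everywhere /=.
apply: (negligibleS _ (negligible_bigcup few_negligible)) => w /= H.
have [iw [q fin]] : infinite_set (component w o) /\ Q w o /\
    finite_set (component w o `&` Q w).
  by apply: contrapT => H'; apply: H => iw q fin; apply: H'.
have [e' ee' e'e] := eb.
have /finite_seqP [s sE] : finite_set (e' @` (component w o `&` Q w)) by exact: finite_image.
exists (size s) => //; split => //; exists s => // k ok wk.
have : [set` s] k by rewrite -sE; exists (e k).
by [].
Qed.

End mass_transport.

(** * The zero-one law *)

Section two_approximations.
Context d (Y : measurableType d) (R : realType) (nu : probability Y R).

(** Write p, f1, f2 for the probabilities. As [E] is covered by the intersection of [F1] and [F2]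
    and by the two symmetric differences, p <= f1 f2 + 2 eta. Moreover each fi is at most p + eta,
    and p and f2 are at most 1, so f1 f2 <= p^2 + 2 eta. *)
Lemma approx_indep (E F1 F2 : set Y) (eta : R) :
  measurable E -> measurable F1 -> measurable F2 ->
  (nu (E `+` F1) <= eta%:E)%E -> (nu (E `+` F2) <= eta%:E)%E ->
  nu (F1 `&` F2) = (nu F1 * nu F2)%E ->
  fine (nu E) * (1 - fine (nu E)) <= 4 * eta.
Proof.
move=> mE m1 m2 H1 H2 H12.
have mY B : measurable B -> measurable (E `+` B).
  by move=> mB; apply: measurableU; exact: measurableD.
have cov F : measurable F -> (nu (E `+` F) <= eta%:E)%E ->
    fine (nu F) <= fine (nu E) + eta.
  move=> mF HF; rewrite -lee_fin EFinD !fineK ?fin_num_measure//.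
  apply: le_trans (leeD (lexx _) HF); apply: measure_cover => //; first exact: mY.
  by move=> y Fy; have [|] := pselect (E y); [left|right; right].
have a1 : fine (nu E) <= 1 by rewrite -lee_fin fineK ?fin_num_measure// probability_le1.
have b1 := cov _ m1 H1; have b2 := cov _ m2 H2.
have b21 : fine (nu F2) <= 1 by rewrite -lee_fin fineK ?fin_num_measure// probability_le1.
have m12 : measurable (F1 `&` F2) by exact: measurableI.
have c : fine (nu E) <= fine (nu F1) * fine (nu F2) + eta + eta.
  rewrite -fineM ?fin_num_measure// -H12.
  rewrite -lee_fin !EFinD !fineK ?fin_num_measure//.
  apply: le_trans (leeD (leeD (lexx _) H1) H2).
  apply: (@le_trans _ _ (nu ((F1 `&` F2) `|` (E `+` F1)) + nu (E `+` F2))%E).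
    apply: measure_cover => //; [apply: measurableU => //; exact: mY|exact: mY|].
    move=> y Ey; have [F1y|] := pselect (F1 y); last by left; right; left.
    by have [F2y|] := pselect (F2 y); [left; left|right; left].
  by apply: leeD => //; apply: measureU2 => //; exact: mY.
have e0 : 0 <= eta by rewrite -lee_fin; apply: le_trans H1.
have f0 : 0 <= fine (nu E) by exact: fine_ge0.
have f1 : 0 <= fine (nu F1) by exact: fine_ge0.
have f2 : 0 <= fine (nu F2) by exact: fine_ge0.
by nra.
Qed.

End two_approximations.

Section zero_one.
Variables (R : realType) (K : Type) (G : graph K) (o : vertex G) (tau : shifts o).
Variable mu : probability (percol G) R.
Hypothesis inv : forall (a : automorphism G) (A : set (percol G)), measurable A ->
  mu [set w : percol G | A (aut_image a w)] = mu A.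
Variables (nu : probability (labels (vertex G) R) R) (m : set R -> \bar R).
Hypothesis iid : iid_law m nu.
Variable e : nat -> vertex G.
Hypothesis eb : bijective e.
Variable E : percol G -> vertex G -> set (labels (vertex G) R).
Hypothesis mE : forall x, measurable [set wl : percol G * labels (vertex G) R | E wl.1 x wl.2].
Hypothesis Eequiv : forall (a : automorphism G) (w : percol G) x (l : labels (vertex G) R),
  E (aut_image a w) (autv a x) l <-> E w x (l \o autv a).
Hypothesis Ecomp : forall w x y, component w x y -> E w x = E w y.

(** By [shift_comp] at the root this translation is idempotent, and it is injective. *)
Lemma shift_root_id v : autv (shift tau o) v = v.
Proof.
apply: (bij_inj (autv_bij (shift tau o))).
by rewrite -shift_comp shift_root.
Qed.

Lemma measurable_event w x : measurable (E w x).
Proof.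
rewrite (_ : E w x = xsection [set wl : percol G * labels (vertex G) R | E wl.1 x wl.2] w).
  exact: measurable_xsection.
by apply/seteqP; split => l; rewrite /xsection /= inE.
Qed.

(** The formula is written for the root [o]; composing with the translation reads it around [x]. *)
Let Ft t x : set (labels (vertex G) R) :=
  [set l : labels (vertex G) R | sem e t (l \o autv (shift tau x))].

Definition near_form t k (w : percol G) x :=
  (nu (E w x `+` Ft t x) <= (k.+1%:R^-1)%:E)%E.

Lemma measurable_shift_form t x : good_form R e t -> measurable (Ft t x).
Proof.
move=> [mt _]; have := measurable_reindex (autv (shift tau x)) measurableT mt.
by rewrite setTI.
Qed.

Lemma measurable_near_form t k x : good_form R e t ->
  measurable [set w | near_form t k w x].
Proof.
(* The sections of [C] are the symmetric differences in [near_form], so their measure is a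
   measurable function of [w]. *)
move=> gt; pose C : set (percol G * labels (vertex G) R) :=
  [set wl | E wl.1 x wl.2] `+` (snd @^-1` Ft t x).
have mC : measurable C.
  have mF : measurable (snd @^-1` Ft t x : set (percol G * labels (vertex G) R)).
    rewrite -[X in measurable X]setTI; apply: measurable_snd => //.
    exact: measurable_shift_form.
  by apply: measurableU; apply: measurableD.
have := emeasurable_fun_infty_c measurableT (measurable_fun_xsection nu mC) (k.+1%:R^-1)%:E.
rewrite setTI; congr measurable; apply/seteqP.
have CE w : xsection C w = E w x `+` Ft t x.
  by apply/seteqP; split => l; rewrite /xsection /= inE.
by split => w; rewrite /near_form /= CE.
Qed.

(** Translating the percolation reindexes the labels in [E] and in the formula in the same way, and
    [nu] is invariant under reindexing. This is the equivariance that mass transport requires. *)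
Lemma near_form_equiv t k y w x : good_form R e t ->
  near_form t k (aut_image (shift tau y) w) (autv (shift tau y) x) <-> near_form t k w x.
Proof.
move=> gt; rewrite /near_form; set a := shift tau y.
have mEF : measurable (E w x `+` Ft t x).
  have mF := measurable_shift_form x gt; have mE' := measurable_event w x.
  by apply: measurableU; exact: measurableD.
rewrite -(iid_reindex iid (autv_bij a) mEF).
suff -> : E (aut_image a w) (autv a x) `+` Ft t (autv a x) =
    [set l : labels (vertex G) R | (E w x `+` Ft t x) (l \o autv a)] by [].
have sE l : Ft t (autv a x) l <-> Ft t x (l \o autv a).
  rewrite /Ft /= (_ : l \o autv (shift tau (autv a x)) = (l \o autv a) \o autv (shift tau x))//.
  by apply/funext => v /=; rewrite shift_comp.
by apply/seteqP; split => l /=; have := sE l; have := Eequiv a w x l; tauto.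
Qed.

Lemma near_form_zero_one t k w : good_form R e t -> near_form t k w o ->
  infinite_set (component w o `&` near_form t k w) ->
  fine (nu (E w o)) * (1 - fine (nu (E w o))) <= 4 * k.+1%:R^-1.
Proof.
move=> gt no inf; have [mt [J fJ dJ]] := gt.
(* The vertices at which the translated support of the formula meets its support at [o]. There are
   finitely many, since translations act freely: each pair [j], [j'] accounts for at most one
   [y]. *)
pose bad := \bigcup_(j in J) \bigcup_(j' in J)
  [set y | autv (shift tau y) j = autv (shift tau o) j'].
have fbad : finite_set bad.
  apply: bigcup_finite => // j _; apply: bigcup_finite => // j' _.
  have [[y yj]|H] := pselect (exists y, autv (shift tau y) j = autv (shift tau o) j').
    apply: sub_finite_set (finite_set1 y) => z /= zj.
    by apply: (shift_free (s := tau) (v := j)); rewrite /= zj yj.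
  by rewrite (_ : [set _ | _] = set0)//; apply/seteqP; split => // y ?; apply: H; exists y.
have [y [[oy ny] nbad]] : exists y, (component w o `&` near_form t k w) y /\ ~ bad y.
  apply: contrapT => H; apply: inf; apply: sub_finite_set fbad => y Hy.
  by apply: contrapT => nb; apply: H; exists y.
have mo := measurable_shift_form o gt; have my := measurable_shift_form y gt.
apply: (approx_indep (measurable_event w o) mo my no).
  by rewrite (Ecomp oy).
apply: (iid_indep iid mo my (J := autv (shift tau o) @` J)).
  by move=> l l' ll'; apply: dJ => v Jv /=; apply: ll'; exists v.
move=> l l' ll'; apply: dJ => v Jv /=; apply: ll' => -[j Jj jv].
by apply: nbad; exists v => //; exists j.
Qed.

Lemma zero_one :
  {ae mu, forall w : percol G, infinite_set (component w o) ->
    nu (E w o) = 0%E \/ nu (E w o) = 1%E}.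
Proof.
have esurj v : exists n, e n = v.
  by have [e' _ e'e] := eb; exists (e' v).
(* The formula approximating [E w o] depends on [w], so a single null set has to serve all pairs of
   a formula and a precision; they are enumerated by [pickle], and an index which codes no suitable
   pair gives a vacuous statement. *)
have H (n : nat) : {ae mu, forall w : percol G,
    forall tk, pickle tk = n -> good_form R e tk.1 -> infinite_set (component w o) ->
    near_form tk.1 tk.2 w o -> infinite_set (component w o `&` near_form tk.1 tk.2 w)}.
  have [[[t k] [tkn gt]]|H] := pselect (exists tk : GenTree.tree (nat * rat) * nat,
      pickle tk = n /\ good_form R e tk.1); last first.
    by apply: aeW => w tk tkn gt; case: H; exists tk.
  have := infinitely_many_in_component inv eb (fun x => measurable_near_form k x gt)
    (fun y w x => near_form_equiv k y w x gt).
  apply: filterS => w Hw [t' k'] /=; rewrite -tkn => /(pcan_inj pickleK) [-> ->] _.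
  exact: Hw.
have := ae_foralln H; apply: filterS => w Hw iw.
have mEo := measurable_event w o.
set a := fine (nu (E w o)).
have aE : nu (E w o) = a%:E by rewrite fineK// fin_num_measure.
have a0 : 0 <= a by exact: fine_ge0.
have a1 : a <= 1 by rewrite -lee_fin -aE probability_le1.
have : a * (1 - a) <= 0.
  apply/ler_addgt0Pr => r r0; rewrite add0r.
  have [k kr] : exists k : nat, 4 * k.+1%:R^-1 <= r.
    have r40 : 0 < r / 4 by rewrite divr_gt0.
    have [k _ Hk] := near_infty_natSinv_lt (PosNum r40).
    exists k; have := Hk k (leqnn k); rewrite /= => /ltW.
    by rewrite ler_pdivlMr// mulrC.
  apply: le_trans kr.
  have k0 : 0 < (k.+1%:R^-1 : R) by rewrite invr_gt0 ltr0n.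
  have [t gt Ht] := formula_approx esurj nu mEo k0.
  have nto : near_form t k w o.
    rewrite /near_form (_ : Ft t o = semset e t)//; apply/seteqP.
    have oE : autv (shift tau o) = id by apply/funext => v; exact: shift_root_id.
    by split => l; rewrite /Ft /semset /= oE.
  by apply: (near_form_zero_one gt nto); exact: (Hw _ (t, k)).
move=> H0; have : a * (1 - a) = 0.
  by apply/eqP; rewrite eq_le H0 mulr_ge0// subr_ge0.
move/eqP; rewrite mulf_eq0 subr_eq0 => /orP [] /eqP H1; rewrite aE.
  by left; rewrite H1.
by right; rewrite -H1.
Qed.

End zero_one.

(** * The local topology *)

Section local_isomorphisms.
Variables (R : realType) (CV CE : pseudoMetricType R).
Implicit Types X Y Z : dgraph CV CE.

Lemma balle_joins X r e x y : joins e x y -> ballv r x -> ballv r y -> @balle R CV CE r X e.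
Proof. by move=> exy rx ry u v /(joins_ends exy) [][-> ->]. Qed.

Lemma hballv_ballv X r : @hballv R CV CE r X `<=` @ballv R CV CE r X.
Proof. by move=> x; apply: (@dist_le_map _ _ _ _ id) => u v [e _ euv]; exists e. Qed.

Lemma hballvS X m n : (m <= n)%N -> @hballv R CV CE m X `<=` @hballv R CV CE n X.
Proof. by move=> mn x; exact: dist_leW. Qed.

Lemma ballvS X m n : (m <= n)%N -> @ballv R CV CE m X `<=` @ballv R CV CE n X.
Proof. by move=> mn x; exact: dist_leW. Qed.

(** * Walks and balls under a local isomorphism *)

Section transport.
Variables (X Y : dgraph CV CE) (r : nat) (p : vertex X -> vertex Y) (q : edge X -> edge Y).
Hypothesis pr : p (root X) = root Y.
Hypothesis pb : set_bij (@ballv R CV CE r X) (@ballv R CV CE r Y) p.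
Hypothesis qb : set_bij (@balle R CV CE r X) (@balle R CV CE r Y) q.
Hypothesis pq : forall e x y, balle r e -> ballv r x -> ballv r y ->
  joins e x y <-> joins (q e) (p x) (p y).

Lemma transport_adj x y : ballv r x -> ballv r y ->
  adj setT x y <-> adj setT (p x) (p y).
Proof.
move=> rx ry; have [pX _ _] := pb; have [_ _ qs] := qb; split.
  case=> e _ exy; exists (q e) => //.
  have re : balle r e by case: exy => exy; exact: balle_joins exy _ _.
  by rewrite -!pq.
case=> e' _ exy.
have : balle r e' by case: exy => exy; apply: balle_joins exy _ _; exact: pX.
by move=> /qs [e re ee']; exists e => //; rewrite !pq// ee'.
Qed.

(** The local isomorphism is controlled only in the ball of radius [r]; [k] bounds the distance from
    the root, so that the walk cannot leave this ball. *)
Lemma transport_walk k n x y : ballv k x -> (k + n <= r)%N ->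
  walk (adj setT) n x y -> walk (adj setT) n (p x) (p y).
Proof.
elim: n k x => [k x _ _ /= -> //|n IH k x kx knr /= [z xz zy]].
have kz : ballv k.+1 z by exact: dist_leS xz.
have kr : (k.+1 <= r)%N by apply: leq_trans knr; rewrite addnS ltnS leq_addr.
exists (p z); last by apply: (IH k.+1) => //; rewrite addSn -addnS.
by apply/transport_adj => //; [exact: ballvS (ltnW kr) _ kx|exact: ballvS kr _ kz].
Qed.

Lemma transport_ball k x : (k <= r)%N -> ballv k x -> ballv k (p x).
Proof.
move=> kr [m mk w]; exists m => //; rewrite -pr.
apply: (transport_walk (k := 0)) w; first exact: dist_le0.
exact: leq_trans kr.
Qed.

Lemma transport_walk_inv k n x y' : ballv k x -> (k + n <= r)%N ->
  walk (adj setT) n (p x) y' -> exists2 y, p y = y' & walk (adj setT) n x y.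
Proof.
have [_ _ ps] := pb.
elim: n k x => [k x _ _ /= <- //|n IH k x kx knr /= [z' xz zy]]; first by exists x.
have kr : (k.+1 <= r)%N by apply: leq_trans knr; rewrite addnS ltnS leq_addr.
have kx' : ballv k (p x) by apply: transport_ball => //; exact: ltnW.
have kz' : ballv r z' by apply: ballvS kr _ _; exact: dist_leS xz.
have [z rz zz'] := ps _ kz'; rewrite -zz' in xz zy.
have {}xz : adj setT x z by apply/transport_adj => //; exact: ballvS (ltnW kr) _ kx.
have kz : ballv k.+1 z by exact: dist_leS xz.
have [|y yy' wy] := IH k.+1 z kz _ zy; first by rewrite addSn -addnS.
by exists y => //; exists z.
Qed.

Lemma transport_ball_inv k x : (k <= r)%N -> ballv r x -> ballv k (p x) -> ballv k x.
Proof.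
move=> kr rx [m mk]; rewrite -pr => w; exists m => //.
have [|y yx wy] := transport_walk_inv (dist_le0 _ 0 _) _ w; first exact: leq_trans kr.
have [_ pi _] := pb; rewrite -(pi y x)// inE; last by [].
by exists m => //; exact: leq_trans kr.
Qed.

End transport.

(** Closeness of colours is not transitive in general, whence the two hypotheses. They hold for
    discrete colours, and make the sets of graphs close to a given one open. *)
Lemma local_close_trans X Y Z r :
  (forall a b c : option CV, col_close r a b -> col_close r b c -> col_close r a c) ->
  (forall a b c : option CE, col_close r a b -> col_close r b c -> col_close r a c) ->
  local_close r X Y -> local_close r Y Z -> local_close r X Z.
Proof.
move=> tv te [p [q [[pr pb qb pq] [[ph qh pd] [pc qc]]]]].
move=> [p' [q' [[pr' pb' qb' pq'] [[ph' qh' pd'] [pc' qc']]]]].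
have [pX _ _] := pb; have [qX _ _] := qb.
have hX x : hballv r x -> hballv r (p x) by move=> rx; rewrite -ph; exists x.
exists (p' \o p), (q' \o q); split; [split|split; [split|split]].
- by rewrite /= pr.
- exact: set_bij_comp pb pb'.
- exact: set_bij_comp qb qb'.
- by move=> e x y re rx ry; rewrite pq// pq'//; [exact: qX|exact: pX|exact: pX].
- by rewrite -image_comp ph.
- by rewrite -image_comp qh.
- by move=> x y n rx ry; rewrite pd// pd'//; exact: hX.
- by move=> x rx; apply: tv (pc _ rx) _; apply: pc'; exact: pX.
- by move=> e re; apply: te (qc _ re) _; apply: qc'; exact: qX.
Qed.

Lemma col_closeS (C : pseudoMetricType R) m n (a b : option C) :
  (0 < m)%N -> (m <= n)%N -> col_close n a b -> col_close m a b.
Proof.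
case: a b => [a|] [b|] //= m0 mn; apply: le_ball.
by rewrite lef_pV2 ?ler_nat// posrE ltr0n// (leq_trans m0).
Qed.

(** Moving the root by [r] costs [r] of the radius [t] and leaves [s]. *)
Lemma local_close_reroot X Y r t : (r <= t)%N -> local_close t X Y ->
  forall y (Hy : hv Y y), hballv r y ->
  exists x (Hx : hv X x), hballv r x /\ forall s, (0 < s)%N -> (r + s <= t)%N ->
    local_close s (reroot Hx) (reroot Hy).
Proof.
move=> rt [p [q [[pr pb qb pq] [[ph qh pd] [pc qc]]]]] y Hy ry.
have : hballv t y by exact: hballvS rt _ ry.
rewrite -ph => -[x xt xy]; subst y.
have rx : hballv r x.
  have H0 : @hballv R CV CE t X (root X) by exact: dist_le0.
  by apply/(pd _ _ _ H0 xt); rewrite pr.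
have Hx : hv X x.
  case: rx => m _; elim: m (root X) (root_hv X) => [z Hz /= <- //|m IH z Hz /= [u zu ux]].
  apply: IH ux; case: zu => e He []; by move/(he_ends He) => [].
exists x, Hx; split => // s s0 rst.
have brx : ballv r x by exact: hballv_ballv.
have hb u : dist_le (adj (he X)) s x u -> hballv t u.
  by move=> xu; apply: dist_leW rst _; exact: dist_le_trans xu.
have hb' u : dist_le (adj (he Y)) s (p x) u -> hballv t u.
  by move=> xu; apply: dist_leW rst _; exact: dist_le_trans xu.
have gb u : dist_le (adj setT) s x u -> ballv t u.
  by move=> xu; apply: dist_leW rst _; exact: dist_le_trans xu.
have gb' u : dist_le (adj setT) s (p x) u -> ballv t u.
  by move=> xu; apply: dist_leW rst _; apply: dist_le_trans xu; exact: hballv_ballv.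
have fwd u : dist_le (adj setT) s x u -> dist_le (adj setT) s (p x) (p u).
  move=> [m ms w]; exists m => //.
  by apply: (transport_walk pb qb pq brx _ w); rewrite (leq_trans _ rst)// leq_add2l.
have [_ pi ps] := pb; have [_ qi qs] := qb.
have bwd u : ballv t u -> dist_le (adj setT) s (p x) (p u) -> dist_le (adj setT) s x u.
  move=> ru [m ms w].
  have [|z zu wz] := transport_walk_inv pr pb qb pq brx _ w.
    by rewrite (leq_trans _ rst)// leq_add2l.
  exists m => //; rewrite -(pi z u)// inE//; apply: gb; by exists m.
have ge e : (forall u v, joins e u v -> dist_le (adj setT) s x u /\
    dist_le (adj setT) s x v) -> @balle R CV CE t X e.
  by move=> H u v /H [/gb ? /gb].
have ge' e : (forall u v, joins e u v -> dist_le (adj setT) s (p x) u /\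
    dist_le (adj setT) s (p x) v) -> @balle R CV CE t Y e.
  by move=> H u v /H [/gb' ? /gb'].
exists p, q; split; [split|split; [split|split]].
- by [].
- split.
  + by move=> u; exact: fwd.
  + by move=> u v; rewrite !inE => xu xv; apply: pi; rewrite inE; exact: gb.
  + move=> u' xu'; have [u ru uu'] := ps _ (gb' _ xu').
    by exists u => //; apply: bwd => //; rewrite uu'.
- split.
  + move=> e He u' v'; have [a [b [ab _]]] := @joinsP _ X e.
    have re := ge _ He; have [xa xb] := He _ _ ab; have [ra rb] := re _ _ ab.
    have := ab; rewrite (pq _ _ _ re ra rb) => ab' /(joins_ends ab').
    by case=> -[-> ->]; split; exact: fwd.
  + by move=> e e'; rewrite !inE => xe xe'; apply: qi; rewrite inE; exact: ge.
  + move=> e' He'; have [e re ee'] := qs _ (ge' _ He'); exists e => // u v uv.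
    have [ru rv] := re _ _ uv.
    have := uv; rewrite (pq _ _ _ re ru rv) ee' => /He' [? ?].
    by split; exact: bwd.
- by move=> e u v /ge re /gb ru /gb rv; exact: pq.
- apply/seteqP; split => [_ [u xu <-]|u' xu'].
    by apply/pd => //; exact: hb.
  have := hb' _ xu'; rewrite -ph => -[u ru uu']; exists u => //.
  by apply/pd => //; rewrite uu'.
- apply/seteqP; split => [_ [e [he1 He] <-]|e' [he1 He']].
    have hre : @hballe R CV CE t X e.
      by split=> // u v /He [xu xv]; split; [exact: (hb _ xu)|exact: (hb _ xv)].
    have : @hballe R CV CE t Y (q e) by rewrite -qh; exists e.
    case=> heq Hq; split => // u' v'.
    have [a [b [ab _]]] := @joinsP _ X e.
    have [xa xb] := He _ _ ab; have ra := hballv_ballv (hb _ xa); have rb := hballv_ballv (hb _ xb).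
    have re : @balle R CV CE t X e by exact: (balle_joins (X := X) ab ra rb).
    have := ab; rewrite (pq _ _ _ re ra rb) => ab' /(joins_ends ab').
    have da := (pd _ _ s xt (hb _ xa)).1 xa; have db := (pd _ _ s xt (hb _ xb)).1 xb.
    by case=> -[-> ->].
  have : @hballe R CV CE t Y e'.
    by split=> // u v /He' [xu xv]; split; [exact: (hb' _ xu)|exact: (hb' _ xv)].
  rewrite -qh => -[e [heX He] ee']; exists e => //; split => // u v uv.
  have [ru rv] := He _ _ uv.
  have [hu hv'] := He _ _ uv.
  have {}ru := hballv_ballv ru; have {}rv := hballv_ballv rv.
  have re : @balle R CV CE t X e by exact: (balle_joins (X := X) uv ru rv).
  have := uv; rewrite (pq _ _ _ re ru rv) ee' => /He' [xu xv].
  by split; [exact: (pd _ _ s xt hu).2 xu|exact: (pd _ _ s xt hv').2 xv].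
- by move=> u v n xu xv; apply: pd; exact: hb.
- move=> u xu; apply: (col_closeS s0 (leq_trans (leq_addl r s) rst)).
  by apply: pc; exact: gb.
- move=> e He; apply: (col_closeS s0 (leq_trans (leq_addl r s) rst)).
  by apply: qc; exact: ge.
Qed.

Lemma finite_hballv X r : finite_set (@hballv R CV CE r X).
Proof.
apply: (@sub_finite_set _ _ (@ballv R CV CE r X)); first exact: hballv_ballv.
exact: finite_gball.
Qed.

Definition local_closure (S : set (dgraph CV CE)) : set (dgraph CV CE) :=
  [set X | forall U, local_open U -> U X -> exists2 Z, S Z & U Z].

Lemma local_open_closureC S : local_open (~` local_closure S).
Proof.
move=> X /= /existsNP [U /not_implyP [oU /not_implyP [UX nU]]].
have [r r0 H] := oU _ UX; exists r => // Y /H UY /(_ _ oU UY).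
exact: nU.
Qed.

(** With the new root restricted to the ball of radius [r] in the component, the set is closed: this
    ball is finite, so one precision excludes the closure at all its vertices at once. The set in
    question is the union over [r]. *)
Lemma borel_reroot_closure S :
  dgraph_borel [set X | exists v (Hv : hv X v), local_closure S (reroot Hv)].
Proof.
pose B r := [set X | exists v (Hv : hv X v), hballv r v /\ local_closure S (reroot Hv)].
have oB r : local_open (~` B r).
  move=> X nB.
  have /choice [s Hs] v : exists s, hballv r v -> forall Hv : hv X v, forall Z,
      local_close s.+1 (reroot Hv) Z -> ~ local_closure S Z.
    have [[rv Hv]|H] := pselect (hballv r v /\ hv X v); last first.
      by exists 0%N => rv Hv; case: H.
    have [[|s] // _ Hs] := @local_open_closureC S (reroot Hv)
      (fun c => nB (ex_intro _ v (ex_intro _ Hv (conj rv c)))).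
    exists s => _ Hv' Z; rewrite (Prop_irrelevance Hv' Hv); exact: Hs.
  have [N HN] : exists N, forall v, hballv r v -> (s v <= N)%N.
    have : finite_set (s @` @hballv R CV CE r X) by exact/finite_image/finite_hballv.
    case/finite_seqP => t tE; exists (\max_(i <- t) i)%N => v rv.
    have : [set` t] (s v) by rewrite -tE; exists v.
    by move=> /= vt; exact: (@leq_bigmax_seq _ t xpredT id).
  (* The part [r] pays for moving the root, and [N.+1] is a precision which suffices at every root
     in the ball. *)
  exists (r + N.+1)%N; first by rewrite addnS.
  move=> Y cXY [y [Hy [ry cy]]].
  have [x [Hx [rx cxy]]] := local_close_reroot (leq_addr _ _) cXY Hy ry.
  apply: (Hs x rx Hx _ _ cy); apply: cxy => //.
  by rewrite leq_add2l ltnS HN.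
rewrite (_ : [set X | _] = \bigcup_r B r).
  apply: sigma_algebra_bigcup => r; rewrite -[B r]setCK -setTD.
  by apply: sigma_algebraCD; apply: sub_sigma_algebra; exact: oB.
apply/seteqP; split => [X [v [Hv c]]|X [r _ [v [Hv [_ c]]]]]; last by exists v, Hv.
have [r vr] := h_connected (root_hv X) Hv.
by exists r => //; exists v, Hv; split => //; exists r.
Qed.

End local_isomorphisms.

(** * Compactness by ultralimits *)

Section ultrafilters.
Variables (U : set_system nat) (UF : UltraFilter U).

Lemma ultra_finite (T : Type) (S : set T) (h : nat -> T) :
  finite_set S -> U [set n | S (h n)] -> exists2 t, S t & U [set n | h n = t].
Proof.
have -> : finite_set S = @finite_set {classic T} S by [].
case/finite_seqP => s ->; elim: s => [|x s IH] Us.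
  by have [n /=] := filter_ex Us; rewrite in_nil.
have [Ux|Ux] := in_ultra_setVsetC [set n | h n = x] UF.
  by exists x; rewrite //= mem_head.
have [|t /= ts Ut] := IH; last by exists t; rewrite //= inE ts orbT.
apply: filterS (filterI Us Ux) => n [/= + hx].
by rewrite inE => /orP [/eqP|].
Qed.

End ultrafilters.

Lemma bool_close (R : realType) r (a b : option bool) : @col_close R bool r a b -> a = b.
Proof. by case: a b => [a|] [b|] //=; rewrite metric_discrete => ->. Qed.

Lemma edge_mark_close (R : realType) (K : Type) r (a b : option (edge_mark K)) :
  @col_close R (edge_mark K) r a b -> a = b.
Proof.
case: a b => [[a1 a2]|] [[b1 b2]|] //= [/=].
by rewrite !metric_discrete => -> ->.
Qed.

Section ultralimits.
Variables (R : realType) (K : Type) (G : graph K).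

Definition plain_scenery (w : subgraph G) (x : vertex G) : dgraph bool (edge_mark K) :=
  scenery w (fun v => `[< sub_v w v >]) x.

(** Closedness in the product topology on {0,1}^V x {0,1}^E, expressed by limits of sequences along
    ultrafilters, the form in which compactness is used. *)
Definition ultraclosed (S : set (subgraph G)) :=
  forall (U : set_system nat), UltraFilter U -> forall (s : nat -> subgraph G) w,
  U [set n | S (s n)] ->
  (forall v, U [set n | sub_v (s n) v <-> sub_v w v]) ->
  (forall e, U [set n | sub_e (s n) e <-> sub_e w e]) -> S w.

(** Colours are discrete here, so closeness of colours becomes equality. These are the data which
    pass to the limit and give an automorphism of [G]; respecting the smaller balls confines the
    images of a fixed vertex to a finite set. *)
Record plain_close (r : nat) (w : subgraph G) (v : vertex G) (w' : subgraph G) (o : vertex G)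
    (p : vertex G -> vertex G) (q : edge G -> edge G) : Prop := PlainClose {
  plain_root : p v = o;
  plain_ballv : set_bij (gball r v) (gball r o) p;
  plain_balle : set_bij (gballe r v) (gballe r o) q;
  plain_joins : forall e x y, gballe r v e -> gball r v x -> gball r v y ->
    joins e x y <-> joins (q e) (p x) (p y);
  plain_ballW : forall k x, (k <= r)%N -> gball k v x -> gball k o (p x);
  plain_ball_inv : forall k x, (k <= r)%N -> gball r v x -> gball k o (p x) -> gball k v x;
  plain_vcol : forall x, gball r v x -> sub_v w' (p x) <-> sub_v w x;
  plain_he : forall e, gballe r v e -> sub_e w' (q e) <-> sub_e w e;
  plain_ecol : forall e, gballe r v e -> ecol (q e) = ecol e }.

Lemma plain_closeP r w v w' o :
  @local_close R bool (edge_mark K) r (plain_scenery w v) (plain_scenery w' o) ->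
  exists p q, plain_close r w v w' o p q.
Proof.
case=> p [q [[pv pb qb pq] [_ [pc qc]]]]; exists p, q.
have asb (Q Q' : Prop) : `[< Q >] = `[< Q' >] -> Q' <-> Q.
  by move=> E; split=> H; apply/asboolP; [rewrite E|rewrite -E]; exact/asboolP.
split => //.
- exact: (transport_ball pv pb qb pq).
- exact: (transport_ball_inv pv pb qb pq).
- by move=> x /pc /bool_close /= [] E; exact: asb E.
- by move=> e /qc /edge_mark_close /= [] E _; exact: asb E.
- by move=> e /qc /edge_mark_close /= [] _ E.
Qed.

(* Konig's lemma, by an ultralimit of the local isomorphisms. *)
Lemma ultralimit (U : set_system nat) (UF : UltraFilter U) (v o : vertex G)
    (w : subgraph G) (s : nat -> subgraph G) :
  (forall N, U [set n | (N <= n)%N]) ->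
  (forall n, @local_close R bool (edge_mark K) n.+1 (plain_scenery w v) (plain_scenery (s n) o)) ->
  exists a : automorphism G, [/\ autv a v = o,
    forall x, U [set n | sub_v (s n) (autv a x) <-> sub_v w x] &
    forall e, U [set n | sub_e (s n) (aute a e) <-> sub_e w e]].
Proof.
move=> Uoo cl.
have /choice [p /choice [q H]] n := plain_closeP (cl n).
have pv n := plain_root (H n).
have pb n := plain_ballv (H n).
have qb n := plain_balle (H n).
have pq n := plain_joins (H n).
have pball n := plain_ballW (H n).
have pball_inv n := plain_ball_inv (H n).
have pcol n := plain_vcol (H n).
have exk x : exists k, gball k v x.
  have : (\bigcup_n gball n v) x by rewrite bigcup_gball.
  by case=> k _; exists k.
have exk' x : exists k, gball k o x.
  have : (\bigcup_n gball n o) x by rewrite bigcup_gball.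
  by case=> k _; exists k.
have exke e : exists k, gballe k v e.
  have : (\bigcup_n gballe n v) e by rewrite bigcup_gballe.
  by case=> k _; exists k.
have exke' e : exists k, gballe k o e.
  have : (\bigcup_n gballe n o) e by rewrite bigcup_gballe.
  by case=> k _; exists k.
have large x : U [set n | gball n.+1 v x].
  have [k kx] := exk x; apply: filterS (Uoo k) => n /= kn.
  exact: gballW (leqW kn) _ kx.
have largee e : U [set n | gballe n.+1 v e].
  have [k kx] := exke e; apply: filterS (Uoo k) => n /= kn.
  exact: gballeW (leqW kn) _ kx.
have qballe n k e : (k <= n.+1)%N -> gballe k v e -> gballe k o (q n e).
  move=> kn ke x' y'; have [x [y [xy _]]] := joinsP e.
  have [kx ky] := ke _ _ xy.
  have := xy; rewrite (pq n _ _ _); [|exact: gballeW ke|exact: gballW kx|exact: gballW ky].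
  by move=> xy' /(joins_ends xy') [][-> ->]; split; exact: pball.
(* For [n] at least [k] the vertex [p n x] lies in a fixed finite ball, so it takes a single value
   along the ultrafilter. *)
have /choice [P HP] x : exists y, U [set n | p n x = y].
  have [k kx] := exk x.
  have [|y _ Hy] := ultra_finite UF (finite_gball k o) (h := fun n => p n x); last by exists y.
  by apply: filterS (Uoo k) => n /= kn; apply: pball => //; exact: leqW.
have /choice [Q HQ] e : exists y, U [set n | q n e = y].
  have [k kx] := exke e.
  have [|y _ Hy] := ultra_finite UF (finite_gballe k o) (h := fun n => q n e); last by exists y.
  by apply: filterS (Uoo k) => n /= kn; apply: qballe => //; exact: leqW.
(* Each property of the limit involves finitely many vertices and edges, so it can be read at one
   common [n]. *)
have Pinj : injective P.
  move=> x y xy.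
  have [n [[[/= Px Py] lx] ly]] := filter_ex
    (filterI (filterI (filterI (HP x) (HP y)) (large x)) (large y)).
  by have [_ pi _] := pb n; apply: pi; rewrite ?inE// Px Py.
have Qinj : injective Q.
  move=> x y xy.
  have [n [[[/= Px Py] lx] ly]] := filter_ex
    (filterI (filterI (filterI (HQ x) (HQ y)) (largee x)) (largee y)).
  by have [_ pi _] := qb n; apply: pi; rewrite ?inE// Px Py.
(* Preimages of [y] under the [p n] also stay in a finite ball, around [v], and their value along
   the ultrafilter is a preimage under [P]; [v] is a default value for small [n]. *)
have /choice [P' PP'] y : exists x, P x = y.
  have [k ky] := exk' y.
  have /choice [x Hx] n : exists x, (k <= n)%N -> gball k v x /\ p n x = y.
    have [kn|] := leqP k n; last by exists v.
    have [_ _ ps] := pb n; have [x nx xy] := ps y (gballW (leqW kn) ky).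
    exists x => _; split => //; apply: (pball_inv n) => //; first exact: leqW.
    by rewrite xy.
  have [|z _ Hz] := ultra_finite UF (finite_gball k v) (h := x).
    by apply: filterS (Uoo k) => n /Hx [].
  exists z; have [n [[/= kn xz] Pz]] := filter_ex (filterI (filterI (Uoo k) Hz) (HP z)).
  by rewrite -Pz -xz; have [] := Hx n kn.
have /choice [Q' QQ'] y : exists x, Q x = y.
  have [k ky] := exke' y.
  have /choice [x Hx] n : exists x, (k <= n)%N -> gballe k v x /\ q n x = y.
    have [kn|] := leqP k n; last by exists y.
    have [_ _ qs] := qb n; have [x nx xy] := qs y (gballeW (leqW kn) ky).
    exists x => _; split => // a b ab; have [na nb] := nx _ _ ab.
    have := ab; rewrite (pq n _ _ _)// xy => /ky [ka kb].
    by split; apply: (pball_inv n) => //; exact: leqW.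
  have [|z _ Hz] := ultra_finite UF (finite_gballe k v) (h := x).
    by apply: filterS (Uoo k) => n /Hx [].
  exists z; have [n [[/= kn xz] Pz]] := filter_ex (filterI (filterI (Uoo k) Hz) (HQ z)).
  by rewrite -Pz -xz; have [] := Hx n kn.
have Pbij : bijective P by exists P' => // x; apply: Pinj; rewrite PP'.
have Qbij : bijective Q by exists Q' => // x; apply: Qinj; rewrite QQ'.
have PQ e x y : joins e x y <-> joins (Q e) (P x) (P y).
  have [n [[[[[/= <- <-] <-] lx] ly] le]] := filter_ex
    (filterI (filterI (filterI (filterI (filterI (HP x) (HP y)) (HQ e))
      (large x)) (large y)) (largee e)).
  exact: pq.
have Qcol e : ecol (Q e) = ecol e.
  have [n [/= <- le]] := filter_ex (filterI (HQ e) (largee e)).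
  exact: (plain_ecol (H n)).
exists (Automorphism Pbij Qbij PQ Qcol); split => /=.
- by have [n /= <-] := filter_ex (HP v).
- by move=> x; apply: filterS (filterI (HP x) (large x)) => n [/= <-]; exact: pcol.
- by move=> e; apply: filterS (filterI (HQ e) (largee e)) => n [/= <-]; exact: (plain_he (H n)).
Qed.

(** Members of [S] which look like [w] on larger and larger balls have an ultralimit, which lies in
    [S] and is the image of [w] under the limit of the local isomorphisms. *)
Lemma ultraclosed_closure (S : set (subgraph G)) (o v : vertex G) (w : subgraph G) :
  ultraclosed S ->
  @local_closure R bool (edge_mark K) [set plain_scenery u o | u in S] (plain_scenery w v) ->
  exists2 a : automorphism G, autv a v = o & S (aut_image a w).
Proof.
move=> uS cl.
have /choice [s Hs] n : exists u, S u /\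
    @local_close R bool (edge_mark K) n.+1 (plain_scenery w v) (plain_scenery u o).
  (* This neighbourhood is open by transitivity of closeness for discrete colours. *)
  have [||_ [u Su <-] wu] := cl [set Z | local_close n.+1 (plain_scenery w v) Z].
  - move=> X cX; exists n.+1 => // Y; apply: local_close_trans cX.
      by move=> a b c /bool_close -> /bool_close ->; exact: col_close_refl.
    by move=> a b c /edge_mark_close -> /edge_mark_close ->; exact: col_close_refl.
  - apply: (@iso_local_close _ _ _ _ _ id id) => //.
    by split => //; exists id.
  - by exists u.
have [U [UF Usub]] := @ultraFilterLemma nat \oo _.
have Uoo N : U [set n | (N <= n)%N] by apply: Usub; exists N.
have [a [av Ha He]] := ultralimit UF Uoo (fun n => (Hs n).2).
exists a => //; have mw := moved_image a w.
apply: (uS _ UF s).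
- by apply: filterS filterT => n _ /=; have [] := Hs n.
- have [b ab ba] := autv_bij a; move=> x; rewrite -(ba x).
  by apply: filterS (Ha (b x)) => n /=; have := moved_v mw (b x); tauto.
- have [b ab ba] := aute_bij a; move=> e; rewrite -(ba e).
  by apply: filterS (He (b e)) => n /=; have := moved_e mw (b e); tauto.
Qed.

End ultralimits.

(** * Regularity and conclusion *)

Section regularity.
Variables (R : realType) (K : Type) (G : graph K) (mu : probability (percol G) R).

Lemma ultraclosed0 : ultraclosed (@set0 (subgraph G)).
Proof. by move=> U UF s w /filter_ex []. Qed.

Lemma ultraclosedU (S S' : set (subgraph G)) :
  ultraclosed S -> ultraclosed S' -> ultraclosed (S `|` S').
Proof.
move=> cS cS' U UF s w US Uv Ue.
have [H|H] := in_ultra_setVsetC [set n | S (s n)] UF; first by left; exact: cS H Uv Ue.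
by right; apply: (cS' _ UF s) Uv Ue; apply: filterS (filterI US H) => n [[]].
Qed.

Lemma ultraclosed_bigcap (S : nat -> set (subgraph G)) :
  (forall n, ultraclosed (S n)) -> ultraclosed (\bigcap_n S n).
Proof.
move=> cS U UF s w US Uv Ue n _; apply: (cS n _ UF s) Uv Ue.
by apply: filterS US => k; exact.
Qed.

Lemma ultraclosed_gen A : subgraph_gen A ->
  ultraclosed A /\ ultraclosed (~` A : set (subgraph G)).
Proof.
move=> [[v ->]|[e ->]]; split => U UF s w US Uv Ue.
- by have [n [/= sn E]] := filter_ex (filterI US (Uv v)); exact/E.
- by have [n [/= sn E]] := filter_ex (filterI US (Uv v)) => /E.
- by have [n [/= sn E]] := filter_ex (filterI US (Ue e)); exact/E.
- by have [n [/= sn E]] := filter_ex (filterI US (Ue e)) => /E.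
Qed.

Let inner (A : set (percol G)) := forall eta : R, 0 < eta -> exists S : set (percol G),
  [/\ ultraclosed S, measurable S, S `<=` A & (mu (A `\` S) <= eta%:E)%E].

Let inner_closed (A : set (percol G)) : measurable A -> ultraclosed A -> inner A.
Proof.
by move=> mA cA r r0; exists A; split => //; rewrite setDv measure0 lee_fin ltW.
Qed.

Let innerU (A B : set (percol G)) : measurable A -> measurable B ->
  inner A -> inner B -> inner (A `|` B).
Proof.
move=> mA mB iA iB r r0; have r20 : 0 < r / 2 by rewrite divr_gt0.
have [S [cS mS SA HS]] := iA _ r20; have [S' [cS' mS' SB HS']] := iB _ r20.
exists (S `|` S'); split.
- exact: ultraclosedU.
- exact: measurableU.
- exact: setUSS.
rewrite [r]splitr EFinD; apply: le_trans (leeD HS HS').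
apply: measure_cover; try (by do ?apply: measurableD; do ?apply: measurableU).
by move=> w [[Aw|Bw] /not_orP [nS nS']]; [left|right].
Qed.

(** Closed sets are stable only under finite unions, so the union is truncated before it is
    approximated. *)
Let inner_bigcup (F : nat -> set (percol G)) : (forall n, measurable (F n)) ->
  (forall n, inner (F n)) -> inner (\bigcup_n F n).
Proof.
move=> mF iF.
have mFN N : measurable (\bigcup_(i < N) F i) by exact: bigcup_measurable.
have iN N : inner (\bigcup_(i < N) F i).
  elim: N => [|N IH].
    by rewrite II0 bigcup_set0; apply: inner_closed => //; exact: ultraclosed0.
  rewrite (_ : \bigcup_(i < N.+1) _ = (\bigcup_(i < N) F i) `|` F N); first exact: innerU.
  by rewrite IIS bigcup_setU bigcup_set1.
move=> r r0; have r20 : 0 < r / 2 by rewrite divr_gt0.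
have [N HN] := measure_bigcup_tail mu mF r20.
have [S [cS mS SF HS]] := iN N _ r20; exists S; split => //.
  by apply: subset_trans SF _ => w [i _ Fi]; exists i.
rewrite [r]splitr EFinD; apply: le_trans (leeD (ltW HN) HS).
have mU : measurable (\bigcup_n F n) by exact: bigcupT_measurable.
apply: measure_cover; do ?exact: measurableD.
move=> w [Fw nS]; have [|] := pselect ((\bigcup_(i < N) F i) w); last by left.
by right.
Qed.

Let inner_bigcap (F : nat -> set (percol G)) : (forall n, measurable (F n)) ->
  (forall n, inner (F n)) -> inner (\bigcap_n F n).
Proof.
move=> mF iF r r0.
have r2 n : 0 < r / (2 ^ n.+1)%:R by rewrite divr_gt0// ltr0n expn_gt0.
have /choice [S HS] n : exists S : set (percol G), [/\ ultraclosed S, measurable S, S `<=` F n &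
    (mu (F n `\` S) <= (r / (2 ^ n.+1)%:R)%:E)%E] by exact: iF.
have mS n : measurable (S n) by case: (HS n).
exists (\bigcap_n S n); split.
- by apply: ultraclosed_bigcap => n; case: (HS n).
- exact: bigcapT_measurable.
- by move=> w Sw n _; have [_ _ + _] := HS n; apply; exact: Sw.
have mSF n : measurable (F n `\` S n) by exact: measurableD.
apply: (@le_trans _ _ (\sum_(n <oo) mu (F n `\` S n))%E).
  apply: measure_sigma_subadditive => //.
    by apply: measurableD; exact: bigcapT_measurable.
  move=> w [Fw /existsNP [n /not_implyP [_ nS]]]; exists n => //; split => //.
  exact: Fw.
apply: le_trans (epsilon_trick0 xpredT (ltW r0)).
by apply: lee_nneseries => // n _; have [_ _ _] := HS n.
Qed.

(** Inner regularity is required of the complement as well: this makes the class stable under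
    complements, and the complement of a countable union is handled by [inner_bigcap]. The
    generators belong to it, being both closed and open. *)
Lemma ultraclosed_inner (A : set (percol G)) (eta : R) : measurable A -> 0 < eta ->
  exists S : set (percol G),
  [/\ ultraclosed S, measurable S, S `<=` A & (mu (A `\` S) <= eta%:E)%E].
Proof.
move=> mA.
pose D : set (set (percol G)) := [set A | [/\ measurable A, inner A & inner (~` A)]].
suff : D A by case=> _ iA _; exact: iA.
have DB (F : (set (percol G))^nat) : (forall n, D (F n)) -> D (\bigcup_n F n).
  move=> DF; have mF n : measurable (F n) by case: (DF n).
  split; first exact: bigcupT_measurable.
    by apply: inner_bigcup => // n; case: (DF n).
  rewrite setC_bigcup; apply: inner_bigcap => n; first exact: measurableC.
  by case: (DF n).
have D0 : D set0.
  split => //; first by apply: inner_closed => //; exact: ultraclosed0.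
  by rewrite setC0; apply: inner_closed => // U UF s w _.
apply: (@smallest_sub _ (sigma_algebra setT) (@subgraph_gen K G) D _ _ A mA).
  split => // B [mB iB iCB]; rewrite setTD; split => //; last by rewrite setCK.
  exact: measurableC.
move=> B gB; have [cB cCB] := ultraclosed_gen gB.
have mB : measurable (B : set (percol G)) by exact: sub_sigma_algebra.
by split => //; apply: inner_closed => //; exact: measurableC.
Qed.

End regularity.

Lemma local_closure_iso (R : realType) (CV CE : pseudoMetricType R)
    (S : set (dgraph CV CE)) X Y p q :
  @iso _ _ X Y p q -> local_closure S X -> local_closure S Y.
Proof.
move=> /iso_sym [p' [q' I]] c U oU UY; apply: c => //.
by have [r r0] := oU _ UY; apply; exact: iso_local_close I.
Qed.

Lemma measurable_fst_preimage d d' (Y : measurableType d) (Z : measurableType d')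
    (A : set Y) : measurable A -> measurable [set yz : Y * Z | A yz.1].
Proof.
by move=> mA; rewrite -[X in measurable X]setTI; apply: measurable_fst.
Qed.

(** * The joint law of percolation and labels, and ergodicity *)

Section main.
Context (R : realType) (d : measure_display) (T : measurableType d).
Variables (P : probability T R) (K : Type) (G : graph K) (o : vertex G).
Variable tau : shifts o.
Variables (om : T -> subgraph G) (perc : percolation om) (inv : aut_invariant P om).
Variables (la : vertex G -> {RV P >-> R}) (iid : iid_uniform01 la).
Hypothesis indep : independent_of_labels om la.
Variables (Xi : metricType R) (sepXi : exists2 D : set Xi, countable D & dense D).
Variables (f : dgraph (bool * R)%type (edge_mark K) -> Xi).
Hypothesis bf : @borel_fun R (bool * R)%type (edge_mark K) Xi f.
Hypothesis inf : all_components_infinite P om.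
Hypothesis indist : indistinguishable_with_scenery P om o.

Let V := vertex G.

Lemma measurable_om : measurable_fun setT (om : T -> percol G).
Proof. by move=> _ A mA; rewrite setTI; exact: perc. Qed.

Definition all_labels (t : T) : labels V R := fun v => la v t.

Lemma measurable_all_labels : measurable_fun setT all_labels.
Proof. by apply: measurable_labels => v; exact: measurable_funPT. Qed.

Let om' : {mfun T >-> percol G} := mfun_Sub (mem_set measurable_om).
Let la' : {mfun T >-> labels V R} := mfun_Sub (mem_set measurable_all_labels).

Lemma measurable_om_labels :
  measurable_fun setT (fun t => (om t, all_labels t) : percol G * labels V R).
Proof.
by apply: measurable_fun_pair; [exact: measurable_om|exact: measurable_all_labels].
Qed.

Let omla : {mfun T >-> (percol G * labels V R)%type} :=
  mfun_Sub (mem_set measurable_om_labels).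

Let mu : probability (percol G) R := distribution P om'.
Let nu : probability (labels V R) R := distribution P la'.

Lemma mu_inv (a : automorphism G) (A : set (percol G)) : measurable A ->
  mu [set w : percol G | A (aut_image a w)] = mu A.
Proof. exact: inv. Qed.

Lemma labels_sigma_preimage B : measurable B -> labels_sigma la (all_labels @^-1` B).
Proof.
move=> mB.
pose D : set (set (labels V R)) := [set B | labels_sigma la (all_labels @^-1` B)].
suff : D B by [].
apply: (@smallest_sub _ (sigma_algebra setT) (@label_gen V R) D _ _ B mB).
  split.
  - by rewrite /D /= preimage_set0; exact: sigma_algebra0.
  - by move=> A DA; rewrite /D /= setTD preimage_setC -setTD; exact: sigma_algebraCD.
  - by move=> F DF; rewrite /D /= preimage_bigcup; exact: sigma_algebra_bigcup.
move=> _ [v [q ->]]; apply: sub_sigma_algebra.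
exists v, `]ratr q, +oo[%classic; split => //.
by apply/seteqP; split => t /=; rewrite in_itv /= andbT.
Qed.

Lemma joint_law (C : set (percol G * labels V R)) : measurable C ->
  P ((fun t => (om t, all_labels t)) @^-1` C) = (mu \x nu)%E C.
Proof.
move=> mC; apply/esym.
apply: (@product_measure_unique _ _ _ _ R mu nu (distribution P omla)) => // A B mA mB.
exact: (indep mA (labels_sigma_preimage mB)).
Qed.

Lemma labels_iid : iid_law (uniform_prob (@ltr01 R)) nu.
Proof.
move=> s B us mB; have [unif ind] := iid.
pose i (k : 'I_(size s)) : {classic V} := tnth (in_tuple s) k.
have iinj : injective i by exact: (elimT (tuple_uniqP (in_tuple s)) us).
transitivity (P (\bigcap_(k in [set: 'I_(size s)]) (la (i k) @^-1` B (i k)))).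
  congr (P _); apply/seteqP; split => t /= H.
    by move=> k _; apply: H; exact: mem_tnth.
  by move=> v /(tnthP (in_tuple s)) [k ->]; exact: (H k I).
rewrite (ind _ i (fun k => B (i k)))// [RHS]big_tnth.
by apply: eq_bigr => k _; rewrite unif.
Qed.

Section invariant_property.
Variable A : set (dgraph (bool * Xi)%type (edge_mark K)).
Hypothesis bA : @dgraph_borel R (bool * Xi)%type (edge_mark K) A.
Hypothesis rA : root_invariant A.

Let E (w : percol G) x : set (labels V R) := [set l | A (decorated f w l x)].

Let mE x : measurable [set wl : percol G * labels V R | E wl.1 x wl.2].
Proof.
apply: (@measurable_decorated _ _ _ _ f bf _ bA sepXi _ _
  (fun wl : percol G * labels V R => wl.1) (fun wl => wl.2)).
- by move=> v; exact: measurable_fst_preimage (measurable_sub_v v).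
- by move=> e; exact: measurable_fst_preimage (measurable_sub_e e).
- by move=> v; exact: (measurableT_comp (measurable_coord v) measurable_snd).
Qed.

Let Eequiv (a : automorphism G) (w : percol G) x (l : labels V R) :
  E (aut_image a w) (autv a x) l <-> E w x (l \o autv a).
Proof.
have := decorated_moved bf bA (l := l \o autv a) (l' := l) x (moved_image a w) (fun=> erefl).
by rewrite /E /=; tauto.
Qed.

Let Ecomp (w : percol G) x y : component w x y -> E w x = E w y.
Proof.
by move=> xy; apply/seteqP; split => l; rewrite /E /= (decorated_component f bA l rA xy).
Qed.

Let full : set (percol G) := [set w | sub_v w o /\ nu (E w o) = 1%E].

Let measurable_full : measurable full.
Proof.
rewrite (_ : full = [set w : percol G | sub_v w o] `&`
  (nu \o xsection [set wl : percol G * labels V R | E wl.1 o wl.2]) @^-1` [set 1%E]).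
  apply: measurableI; first exact: measurable_sub_v.
  by rewrite -[X in measurable X]setTI; apply: (measurable_fun_xsection nu (mE o)).
apply/seteqP.
have XE w : xsection [set wl : percol G * labels V R | E wl.1 o wl.2] w = E w o.
  by apply/seteqP; split => l; rewrite /xsection /= inE.
by split => w /=; rewrite /full /= XE.
Qed.

(** Stated for all automorphisms and not only for translations, since compactness produces arbitrary
    ones. *)
Let nu_equiv a w x : nu (E (aut_image a w) (autv a x)) = nu (E w x).
Proof.
rewrite -(iid_reindex labels_iid (autv_bij a) (measurable_event mE w x)).
by congr (nu _); apply/seteqP; split => l; rewrite /= Eequiv.
Qed.

Let event : set T := [set t | sub_v (om t) o] `&`
  (fun t => A (scenery (om t) (fun v => (`[< sub_v (om t) v >],
    fiid f (om t) (fun v => la v t) v)) o)).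

Let C : set (percol G * labels V R) :=
  [set wl | sub_v wl.1 o] `&` [set wl | E wl.1 o wl.2].

Let mC : measurable C.
Proof.
apply: measurableI; last exact: mE.
exact: measurable_fst_preimage (measurable_sub_v o).
Qed.

Let measurable_present : measurable [set t | sub_v (om t) o].
Proof. exact: (perc (measurable_sub_v o)). Qed.

(** A finite graph has no infinite component, so [o] is almost surely not in the percolation. The
    case is set apart because the main argument enumerates the vertices bijectively by [nat]. *)
Lemma finite_ergodic : finite_set [set: vertex G] -> P event = 0%E.
Proof.
move=> fV.
have P0 : P [set t | sub_v (om t) o] = 0%E.
  apply/negligibleP => //; apply: negligibleS inf => t /= ot H.
  by apply: (H o ot); exact: sub_finite_set fV.
have mev : measurable event.
  rewrite (_ : event = (fun t => (om t, all_labels t)) @^-1` C)//.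
  by rewrite -[X in measurable X]setTI; exact: measurable_om_labels.
apply/eqP; rewrite eq_le measure_ge0 andbT -P0.
by apply: le_measure; rewrite ?inE// => t [].
Qed.

Variable e : nat -> vertex G.
Hypothesis eb : bijective e.

(** The null set given by [inf] lives in [T] and does not push forward, so the exceptional subgraphs
    are first written as a measurable set [Z]: a finite component is one that misses [e k] from some
    [k] on. *)
Let ae_infinite : {ae mu, forall w : percol G, sub_v w o -> infinite_set (component w o)}.
Proof.
pose Z : set (percol G) := [set w | sub_v w o] `&` \bigcup_N \bigcap_(k in [set k | (N <= k)%N])
  ~` [set w : percol G | component w o (e k)].
have mZ : measurable Z.
  apply: measurableI; first exact: measurable_sub_v.
  apply: bigcupT_measurable => N; apply: bigcap_measurableType => k _.
  by apply: measurableC; exact: measurable_component.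
have Z0 : P (om @^-1` Z) = 0%E.
  apply/negligibleP; first exact: perc.
  apply: negligibleS inf => t /= [ot [N _ HN]] H.
  have [k Nk ok] := infinite_component_unbounded eb N (H o ot).
  exact: (HN k Nk).
exists Z; split => // w /= /not_implyP [wo fin]; split => //.
have {}fin : finite_set (component w o) by exact: contrapT.
have [e' ee' e'e] := eb.
have /finite_seqP [s sE] : finite_set (e' @` component w o) by exact: finite_image.
exists (\max_(k <- s) k).+1 => // k /= sk wk.
have : [set` s] k by rewrite -sE; exists (e k).
by move=> /= ks; have := @leq_bigmax_seq _ s xpredT id k ks isT; rewrite leqNgt sk.
Qed.

Let ae_zero_one : {ae mu, forall w : percol G, sub_v w o ->
  nu (E w o) = 0%E \/ nu (E w o) = 1%E}.
Proof.
have := zero_one tau mu_inv labels_iid eb mE Eequiv Ecomp.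
move=> H; apply: filterS2 ae_infinite H => w infw inf01 /infw; exact: inf01.
Qed.

(** By Fubini the probability is the integral of p over the subgraphs containing [o], and there p is
    almost surely the indicator of [full]. *)
Let prob_full : P event = mu full.
Proof.
transitivity ((mu \x nu)%E C); first exact: (joint_law mC).
have CE w : sub_v w o -> xsection C w = E w o.
  by move=> wo; apply/seteqP; split => l; rewrite /xsection /= inE; [case|].
have CE0 w : ~ sub_v w o -> xsection C w = set0.
  by move=> wo; apply/seteqP; split => // l; rewrite /xsection /= inE => -[].
transitivity (\int[mu]_w (\1_full w)%:E)%E; last by rewrite integral_indic// setIT.
apply: ae_eq_integral => //.
- exact: measurable_fun_xsection.
- by apply/measurable_EFinP; exact: measurable_indic.
apply: filterS ae_zero_one => w Hw _ /=.
have [wo|wo] := pselect (sub_v w o); last first.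
  by rewrite CE0// measure0 indicE memNset// => -[].
rewrite CE//; have [H|H] := Hw wo; rewrite H indicE.
  by rewrite memNset// => -[_]; rewrite H => /eqP; rewrite eq_sym onee_eq0.
by rewrite mem_set.
Qed.

Let full_zero_one : mu full = 0%E \/ mu full = P [set t | sub_v (om t) o].
Proof.
have /choice [S HS] (n : nat) : exists S : set (percol G),
    [/\ ultraclosed S, measurable S, S `<=` full & (mu (full `\` S) <= (n.+1%:R^-1)%:E)%E].
  by apply: ultraclosed_inner => //; rewrite invr_gt0 ltr0n.
(* Letting the root range over the component makes the property root-invariant, and taking closures
   makes it Borel. *)
pose A' : set (dgraph bool (edge_mark K)) := \bigcup_n [set X | exists v (Hv : hv X v),
  @local_closure R bool (edge_mark K) [set plain_scenery u o | u in S n] (reroot Hv)].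
have bA' : @dgraph_borel R bool (edge_mark K) A'.
  by apply: sigma_algebra_bigcup => n; exact: borel_reroot_closure.
have rA' : @root_invariant R bool (edge_mark K) A'.
  by move=> X v Hv [n _ [u [Hu c]]]; exists n => //; exists u, Hu.
pose B : set (percol G) := [set w | sub_v w o /\ A' (plain_scenery w o)].
have mB : measurable B.
  apply: (@measurableI _ _ [set w : percol G | sub_v w o]
    [set w : percol G | A' (plain_scenery w o)]); first exact: measurable_sub_v.
  apply: (@measurable_scenery _ (percol G) R K G bool (fun w => w)
    (fun v w => `[< sub_v w v >])) => // [a|v].
    exact: measurable_sub_e.
  apply: codable_bool; have := @measurable_sub_v _ G v.
  congr measurable; apply/seteqP; split => w /=; by case: asboolP.
(* The conditional probability is the same at [o] for [w], at [v] in its component, and at [o] for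
   the image of [w] under the automorphism obtained by compactness; this image is in [S n], so the
   value is 1. *)
have Bfull : B `<=` full.
  move=> w [wo [n _ [v [Hv c]]]]; split => //.
  have {}c := local_closure_iso (iso_scenery_reroot _ Hv) c.
  have [cS _ Sfull _] := HS n.
  have [a av Sa] := ultraclosed_closure cS c.
  have [_ H] := Sfull _ Sa.
  by rewrite (Ecomp Hv) -(nu_equiv a) av.
(* Taking closures loses nothing: a subgraph in [S n] has the property from the root [o] itself. *)
have fullB n : full `\` B `<=` full `\` S n.
  move=> w [fw nB]; split => // Sw; apply: nB; split; first by case: fw.
  exists n => //; exists o, (component_refl w o) => U oU UX.
  exists (plain_scenery w o); first by exists w.
  have [r r0] := oU _ UX; apply.
  exact: (iso_local_close r0 (iso_scenery_reroot _ (component_refl w o))).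
have mfB : measurable (full `\` B) by apply: measurableD.
have fB0 : mu (full `\` B) = 0%E.
  apply/eqP; rewrite eq_le measure_ge0 andbT; apply/lee_addgt0Pr => r r0; rewrite add0e.
  have [n _ Hn] := near_infty_natSinv_lt (PosNum r0).
  apply: (@le_trans _ _ (n.+1%:R^-1)%:E); last first.
    by rewrite lee_fin ltW//; exact: (Hn n (leqnn n)).
  have [_ mS _ HSn] := HS n; apply: le_trans HSn.
  by apply: le_measure; rewrite ?inE//; exact: measurableD.
have -> : mu full = mu B.
  apply: etrans (measureDI _ measurable_full mB) _; rewrite (setIidr Bfull).
  by apply: etrans (congr1 (fun z => z + _)%E fB0) _; exact: add0e.
exact: (indist bA' rA').
Qed.

Lemma infinite_ergodic : P event = 0%E \/ P event = P [set t | sub_v (om t) o].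
Proof. by rewrite prob_full; exact: full_zero_one. Qed.

End invariant_property.

Lemma decorated_ergodic : indistinguishable_with_decorated_scenery P om
  (fun t => fiid f (om t) (fun v => la v t)) o.
Proof.
move=> A bA rA.
have [fV|iV] := pselect (finite_set [set: vertex G]); first by left; exact: finite_ergodic.
have /card_set_bijP [k [_ ki ks]] := eq_card_nat (countable_vertex o) iV.
have /choice [e ek] n : exists v, k v = n by have [v _ <-] := ks n I; exists v.
have eb : bijective e.
  by exists k => // v; apply: ki; rewrite ?inE.
exact: (infinite_ergodic bA rA eb).
Qed.

End main.

(** * Cayley graphs *)

Section left_translations.
Variables (Gam : Type) (grp : Group.axioms_ Gam).
HB.instance Definition _ := grp.
Variable S : set Gam.
Hypotheses (finS : finite_set S) (genS : generates grp S).

Local Notation diagram := (cayley_diagram finS genS).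
Local Notation cgraph := (cayley_graph finS genS).

Let mulg_bij (x : Gam) : bijective (fun y : Gam => (x * y)%g).
Proof. by exists (fun y => (x^-1 * y)%g) => y; rewrite ?mulKg ?mulVKg. Qed.

Definition diagram_translation (x : Gam) : automorphism diagram.
Proof.
refine (@Automorphism Gam diagram (fun y : Gam => (x * y)%g)
  (fun e : Gam * {g | S g} => ((x * e.1)%g, e.2)) (mulg_bij x) _ _ _) => //.
  by exists (fun e => ((x^-1 * e.1)%g, e.2)) => -[y g] /=; rewrite ?mulKg ?mulVKg.
move=> e u v; rewrite /joins /= /diagram_joins /=; split=> [[-> ->]|[Hu Hv]].
  by rewrite mulgA.
by split; apply: (mulgI x); rewrite ?mulgA.
Defined.

Let translated_edge (x : Gam) (e : cayley_edge grp S) :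
  exists y g, S g /\ [set (x * z)%g | z in sval e] = [set y; (y * g)%g].
Proof.
case: e => e [y [g [Sg E]]] /=; exists (x * y)%g, g; split => //.
by rewrite E image_setU !image_set1 mulgA.
Qed.

Let translate_edge x e : cayley_edge grp S :=
  exist _ [set (x * z)%g | z in sval e] (translated_edge x e).

Let translate_edgeK x : cancel (translate_edge x) (translate_edge x^-1%g).
Proof.
move=> [e He]; apply: eq_exist; apply/seteqP; split => [_ [_ [z ez <-] <-]|z ez] /=.
  by rewrite mulKg.
by exists (x * z)%g; [exists z|rewrite mulKg].
Qed.

Definition graph_translation (x : Gam) : automorphism cgraph.
Proof.
refine (@Automorphism Gam cgraph (fun y : Gam => (x * y)%g) (translate_edge x)
  (mulg_bij x) _ _ _) => //.
  exists (translate_edge x^-1%g); first exact: translate_edgeK.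
  by move=> e; rewrite -{1}[x]invgK translate_edgeK.
move=> e u v; rewrite /joins /= /cayley_joins /=.
have -> : [set (x * u)%g; (x * v)%g] = [set (x * z)%g | z in [set u; v]].
  apply/seteqP; split => z; last by case=> t [] -> <-; [left|right].
  by case=> ->; [exists u; first left|exists v; first right].
split => [-> //|E].
apply/seteqP; split => z Hz.
  have : [set (x * z)%g | z in sval e] (x * z)%g by exists z.
  by rewrite E => -[t Ht xtz]; rewrite -(mulgI x _ _ xtz).
have : [set (x * z)%g | z in [set u; v]] (x * z)%g by exists z.
by rewrite -E => -[t Ht xtz]; rewrite -(mulgI x _ _ xtz).
Defined.

(** Left multiplication by [x * o^-1] takes [o] to [x], and it takes [o * x^-1 * o] to [o], whence
    the two witnesses. *)
Lemma cayley_shifts (G : graph Gam) :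
  G = cgraph \/ G = diagram -> forall o : vertex G, inhabited (shifts o).
Proof.
have s1 (o x : Gam) : (x * o^-1 * o)%g = x by rewrite mulgVK.
have s2 (o x : Gam) : (x * o^-1 * (o * x^-1 * o))%g = o.
  by rewrite !mulgA mulgVK mulgV mul1g.
have s3 (o : Gam) : injective (fun x : Gam => (o * x^-1 * o)%g).
  by move=> x y xy; apply/invg_inj/(mulgI o)/(mulIg o).
have s4 (o x y v : Gam) : (x * o^-1 * y * o^-1 * v)%g = (x * o^-1 * (y * o^-1 * v))%g.
  by rewrite !mulgA.
have s5 (o v : Gam) : injective (fun x : Gam => (x * o^-1 * v)%g).
  by move=> x y xy; apply/(mulIg o^-1%g)/(mulIg v).
case=> -> o; split.
  exact: (@Shifts _ cgraph o (fun x => graph_translation (x * (o : Gam)^-1)%g)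
    (fun x => (o * (x : Gam)^-1 * o)%g) (s1 o) (s2 o) (s3 o) (s4 o) (s5 o)).
exact: (@Shifts _ diagram o (fun x => diagram_translation (x * (o : Gam)^-1)%g)
  (fun x => (o * (x : Gam)^-1 * o)%g) (s1 o) (s2 o) (s3 o) (s4 o) (s5 o)).
Qed.

End left_translations.

Theorem lemma2p2 (R : realType) (d : measure_display) (T : measurableType d)
  (P : probability T R)
  (Gam : Type) (grp : Group.axioms_ Gam)
  (S : set Gam) (finS : finite_set S) (genS : generates grp S)
  (G : graph Gam)
  (hG : G = cayley_graph finS genS \/ G = cayley_diagram finS genS)
  (o : vertex G)
  (om : T -> subgraph G) (perc : percolation om) (inv : aut_invariant P om)
  (la : vertex G -> {RV P >-> R}) (iid : iid_uniform01 la)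
  (indep : independent_of_labels om la)
  (Xi : metricType R) (sepXi : exists2 D : set Xi, countable D & dense D)
  (f : dgraph (bool * R)%type (edge_mark Gam) -> Xi)
  (borelf : @borel_fun R (bool * R)%type (edge_mark Gam) Xi f)
  (inf : all_components_infinite P om)
  (indist : indistinguishable_with_scenery P om o) :
  indistinguishable_with_decorated_scenery P om
    (fun t => fiid f (om t) (fun v => la v t)) o.
Proof.
have [tau] := cayley_shifts hG o.
exact: decorated_ergodic.
Qed.
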